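(* Let $\mathbb{F}$ be an algebraically closed field of characteristic different from $2$, $\mathcal{C}$ the Cayley algebra over $\mathbb{F}$, and $G$ an abelian group. For a $G$-grading $\Gamma$ on $\mathcal{C}\otimes\mathcal{C}$ let $\Gamma_0$ be the induced $G$-grading on the algebra $\mathcal{S}=(\mathcal{C}_0\otimes\mathbb{F}1)\oplus(\mathbb{F}1\otimes\mathcal{C}_0)$ with product the commutator. (1) If $\mathcal{S}$ with $\Gamma_0$ is not graded-simple, i.e., $\mathcal{C}_0\otimes\mathbb{F}1$ and $\mathbb{F}1\otimes\mathcal{C}_0$ are $G$-graded ideals of $\mathcal{S}$, then $\Gamma_0$ is isomorphic to a product $G$-grading $\Gamma_0^1\times_G\Gamma_0^2$ for some $G$-gradings $\Gamma_0^1$ on $\mathcal{C}_0\otimes\mathbb{F}1$ and $\Gamma_0^2$ on $\mathbb{F}1\otimes\mathcal{C}_0$. (2) Let $\Gamma$ and $\Gamma'$ be $G$-gradings on $\mathcal{C}\otimes\mathcal{C}$, with induced $G$-gradings $\Gamma_0$ and $\Gamma_0'$ on $\mathcal{S}$. Let $\Gamma_0^1,\Gamma_0'^1$ be $G$-gradings on $\mathcal{C}_0\otimes\mathbb{F}1$ and $\Gamma_0^2,\Gamma_0'^2$ be $G$-gradings on $\mathbb{F}1\otimes\mathcal{C}_0$ such that $\Gamma_0\simeq\Gamma_0^1\times_G\Gamma_0^2$ and $\Gamma_0'\simeq\Gamma_0'^1\times_G\Gamma_0'^2$. Then $\Gamma$ and $\Gamma'$ are isomorphic if and only if either $\Gamma_0^1\simeq\Gamma_0'^1$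 and $\Gamma_0^2\simeq\Gamma_0'^2$, or $\Gamma_0^1\simeq\Gamma_0'^2$ and $\Gamma_0^2\simeq\Gamma_0'^1$.
   Context: The Cayley algebra is the unique (up to isomorphism) $8$-dimensional unital composition algebra over $\mathbb{F}$; $\mathcal{C}_0$ is its space of skew elements with respect to the standard involution $\bar x=n(x,1)1-x$. A $G$-grading on an algebra $\mathcal{A}$ is a decomposition $\mathcal{A}=\bigoplus_{g\in G}\mathcal{A}_g$ with $\mathcal{A}_g\mathcal{A}_h\subseteq\mathcal{A}_{gh}$. Two $G$-gradings on algebras $\mathcal{A},\mathcal{B}$ are isomorphic ($\simeq$) if there is an algebra isomorphism $\mathcal{A}\to\mathcal{B}$ mapping $\mathcal{A}_g$ onto $\mathcal{B}_g$ for all $g\in G$. A graded algebra is graded-simple if its product is nonzero and its only graded ideals are $0$ and itself. Every $G$-grading and every automorphism of $\mathcal{C}\otimes\mathcal{C}$ preserves the tensor product of the standard involutions, whose space of skew elements is $\mathcal{S}=(\mathcal{C}_0\otimes\mathbb{F}1)\oplus(\mathbb{F}1\otimes\mathcal{C}_0)$; so $\mathcal{S}$ is a graded subspace, and it is closed under commutators. $\mathcal{C}_0\otimes\mathbb{F}1$ and $\mathbb{F}1\otimes\mathcal{C}_0$ are algebras under the commutator, both isomorphic to $\mathcal{C}_0$. Given $G$-gradings $\Gamma^1$ on $\mathcal{A}$ and $\Gamma^2$ on $\mathcal{B}$, the product $G$-grading $\Gamma^1\times_G\Gamma^2$ on $\mathcal{A}\times\mathcal{B}\simeq\mathcal{A}\oplus\mathcal{B}$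 has components $\mathcal{A}_g\times\mathcal{B}_g$, $g\in G$. *)

(* Defs.v *)
From HB Require Import structures.
From mathcomp Require Import all_boot all_order all_algebra.
From mathcomp Require Import ring.

Set Implicit Arguments.
Unset Strict Implicit.
Unset Printing Implicit Defensive.

Import GRing.Theory.
Local Open Scope ring_scope.

(* Finite-dimensional algebras: neither associative nor unital in general. *)
Record nalgebra (F : fieldType) := NAlgebra {
  nalg_sort :> vectType F;
  nalg_mul : {bilinear nalg_sort -> nalg_sort -> nalg_sort}
}.

Declare Scope nalg_scope.
Delimit Scope nalg_scope with NA.
Local Open Scope nalg_scope.
Notation "x ** y" := (nalg_mul _ x y)
  (at level 40, left associativity) : nalg_scope.

Section Constructions.
Variable F : fieldType.

Section Commutator.
Variable A : nalgebra F.

Definition comm_mul (x y : A) : A := x ** y - y ** x.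

Fact comm_mul_is_bilinear : bilinear_for *:%R *:%R comm_mul.
Proof.
split=> [u|u] a x y; rewrite /comm_mul /applyr.
  by rewrite linearPl linearPr /= scalerBr opprD addrACA.
by rewrite linearPl linearPr /= scalerBr opprD addrACA.
Qed.
HB.instance Definition _ :=
  bilinear_isBilinear.Build F A A A *:%R *:%R comm_mul comm_mul_is_bilinear.

Definition commA : nalgebra F :=
  @NAlgebra F (nalg_sort A) (comm_mul : {bilinear A -> A -> A}).

End Commutator.

Section Subalgebra.
Variables (A : nalgebra F) (U : {vspace A}).

Definition mul_closed : Prop := forall x y : A, x \in U -> y \in U -> x ** y \in U.

Hypothesis clU : mul_closed.

Definition sub_mul (x y : subvs_of U) : subvs_of U :=
  Subvs (clU (subvsP x) (subvsP y)).

Fact sub_mul_is_bilinear : bilinear_for *:%R *:%R sub_mul.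
Proof.
by split=> [u|u] a x y; apply: val_inj; rewrite /= ?linearPl ?linearPr.
Qed.
HB.instance Definition _ :=
  bilinear_isBilinear.Build F (subvs_of U) (subvs_of U) (subvs_of U)
    *:%R *:%R sub_mul sub_mul_is_bilinear.

Definition subA : nalgebra F :=
  @NAlgebra F (subvs_of U)
    (sub_mul : {bilinear subvs_of U -> subvs_of U -> subvs_of U}).

Definition restrv (W : {vspace A}) : {vspace subA} :=
  (linfun (vsval : subvs_of U -> A) @^-1: W)%VS.

Lemma memv_restrv W (x : subA) : (x \in restrv W) = (vsval x \in W).
Proof. by rewrite -memv_preim lfunE. Qed.

End Subalgebra.

Section Product.
Variables A B : nalgebra F.

Definition prod_mul (x y : A * B) : A * B := (x.1 ** y.1, x.2 ** y.2).

Fact prod_mul_is_bilinear : bilinear_for *:%R *:%R prod_mul.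
Proof.
by split=> [u|u] a x y; rewrite /prod_mul /applyr /= ?linearPl ?linearPr.
Qed.
HB.instance Definition _ :=
  bilinear_isBilinear.Build F (A * B)%type (A * B)%type (A * B)%type
    *:%R *:%R prod_mul prod_mul_is_bilinear.

Definition prodA : nalgebra F :=
  @NAlgebra F (A * B)%type (prod_mul : {bilinear A * B -> A * B -> A * B}).

Definition prodv (U : {vspace A}) (W : {vspace B}) : {vspace prodA} :=
  (linfun (fst : A * B -> A) @^-1: U :&: linfun (snd : A * B -> B) @^-1: W)%VS.

Lemma memv_prodv U W (x : A) (y : B) :
  ((x, y) \in prodv U W) = (x \in U) && (y \in W).
Proof. by rewrite memv_cap -!memv_preim !lfunE. Qed.

End Product.

(* A tensor of U (x) V is represented by the matrix of its coordinates on the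
   products of basis vectors; tensvP is the universal property and tens_mulE
   characterizes the product of the tensor product algebra. *)
Section TensorVect.
Variables U V : vectType F.

Definition tensv : Type := 'M[F]_(\dim {:U}, \dim {:V}).
HB.instance Definition _ := Vector.on tensv.

Definition tens (u : U) (v : V) : tensv :=
  \matrix_(i, j) (coord (vbasis {:U}) i u * coord (vbasis {:V}) j v).

Fact tens_is_bilinear : bilinear_for *:%R *:%R tens.
Proof.
split=> [u|u] a x y; apply/matrixP=> i j; rewrite !mxE linearP /=.
  by rewrite mulrDl mulrA.
by rewrite mulrDr mulrCA.
Qed.
HB.instance Definition _ :=
  bilinear_isBilinear.Build F U V tensv *:%R *:%R tens tens_is_bilinear.

Definition stdb (W : vectType F) (i : 'I_(\dim {:W})) : W := (vbasis {:W})`_i.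

Lemma tens_stdb i j : tens (stdb i) (stdb j) = delta_mx i j.
Proof.
apply/matrixP=> k l; rewrite !mxE /stdb !coord_free ?(basis_free (vbasisP _)) //.
by rewrite -natrM mulnb (eq_sym i) (eq_sym j).
Qed.

Lemma tensv_basis (t : tensv) :
  t = \sum_i \sum_j t i j *: tens (stdb i) (stdb j).
Proof.
rewrite {1}[t]matrix_sum_delta.
by apply: eq_bigr => i _; apply: eq_bigr => j _; rewrite tens_stdb.
Qed.

Lemma stdb_sum (W : vectType F) (w : W) : w = \sum_i coord (vbasis {:W}) i w *: stdb i.
Proof. exact: coord_vbasis (memvf w). Qed.

Lemma tensvP (W : vectType F) (f : {bilinear U -> V -> W}) :
  exists2 h : {linear tensv -> W}, (forall u v, h (tens u v) = f u v) &
    forall h' : {linear tensv -> W}, (forall u v, h' (tens u v) = f u v) ->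
      h' =1 h.
Proof.
pose h0 (t : tensv) : W := \sum_i \sum_j t i j *: f (stdb i) (stdb j).
have lin_h0 : linear h0.
  move=> a x y; rewrite /h0 scaler_sumr -big_split; apply: eq_bigr => i _ /=.
  rewrite scaler_sumr -big_split; apply: eq_bigr => j _ /=.
  by rewrite !mxE scalerDl scalerA.
pose hL := GRing.isLinear.Build F tensv W *:%R h0 lin_h0.
pose h : {linear tensv -> W} := HB.pack h0 hL.
exists h => [u v|h' h'P t].
  rewrite {2}[u]stdb_sum linear_sumlz; apply: eq_bigr => i _ /=.
  rewrite {2}[v]stdb_sum linear_sumr; apply: eq_bigr => j _ /=.
  by rewrite linearZl_LR linearZr_LR scalerA mxE.
rewrite {1}[t]tensv_basis linear_sum; apply: eq_bigr => i _.
by rewrite linear_sum; apply: eq_bigr => j _; rewrite linearZ /= h'P.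
Qed.

End TensorVect.

Section TensorAlgebra.
Variables A B : nalgebra F.

Definition tens_mul (s t : tensv A B) : tensv A B :=
  \sum_i \sum_j \sum_k \sum_l
    (s i j * t k l) *: tens (nalg_mul A (stdb i) (stdb k)) (nalg_mul B (stdb j) (stdb l)).

Fact tens_mul_is_bilinear : bilinear_for *:%R *:%R tens_mul.
Proof.
split=> u a x y; rewrite /tens_mul /applyr /=;
  rewrite scaler_sumr -big_split; apply: eq_bigr => i _ /=;
  rewrite scaler_sumr -big_split; apply: eq_bigr => j _ /=;
  rewrite scaler_sumr -big_split; apply: eq_bigr => k _ /=;
  rewrite scaler_sumr -big_split; apply: eq_bigr => l _ /=;
  rewrite !mxE scalerA -scalerDl; congr (_ *: _).
  by rewrite mulrDl mulrA.
by rewrite mulrDr mulrCA.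
Qed.
HB.instance Definition _ :=
  bilinear_isBilinear.Build F (tensv A B) (tensv A B) (tensv A B)
    *:%R *:%R tens_mul tens_mul_is_bilinear.

Definition tensA : nalgebra F :=
  @NAlgebra F (tensv A B)
    (tens_mul : {bilinear tensv A B -> tensv A B -> tensv A B}).

Lemma tens_mulE (a c : A) (b d : B) :
  nalg_mul tensA (tens a b) (tens c d) = tens (a ** c) (b ** d).
Proof.
rewrite {2}[a]stdb_sum linear_sumlz linear_sumlz; apply: eq_bigr => i _ /=.
rewrite {2}[b]stdb_sum linear_sumlz linear_sumr; apply: eq_bigr => j _ /=.
rewrite {2}[c]stdb_sum linear_sumr linear_sumlz; apply: eq_bigr => k _ /=.
rewrite {2}[d]stdb_sum !linear_sumr; apply: eq_bigr => l _ /=.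
rewrite !(linearZl_LR, linearZr_LR) /= !scalerA; congr (_ *: _).
by rewrite !mxE; ring.
Qed.

End TensorAlgebra.

End Constructions.

(* A unital algebra with a nonsingular multiplicative quadratic form. *)
Record compositionAlgebra (F : fieldType) := CompositionAlgebra {
  comp_alg :> nalgebra F;
  comp_one : comp_alg;
  comp_norm : comp_alg -> F;
  comp_polar (x y : comp_alg) := comp_norm (x + y) - comp_norm x - comp_norm y;
  comp_mul1l : forall x : comp_alg, comp_one ** x = x;
  comp_mulr1 : forall x : comp_alg, x ** comp_one = x;
  comp_normZ : forall a x, comp_norm (a *: x) = a ^+ 2 * comp_norm x;
  comp_polarP : bilinear_for *%R *%R comp_polar;
  comp_polar_nondegenerate :
    forall x, (forall y, comp_polar x y = 0) -> x = 0;
  comp_normM : forall x y : comp_alg,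
    comp_norm (x ** y) = comp_norm x * comp_norm y
}.

Record cayleyAlgebra (F : fieldType) := CayleyAlgebra {
  cayley_comp :> compositionAlgebra F;
  cayley_dim : \dim {: cayley_comp} = 8%N
}.

Section Skew.
Variables (F : fieldType) (C : compositionAlgebra F).
Local Notation one := (comp_one C).

HB.instance Definition _ :=
  bilinear_isBilinear.Build F C C F *%R *%R (@comp_polar F C)
    (@comp_polarP F C).

Definition comp_conj (x : C) : C := comp_polar x one *: one - x.

Fact comp_conj_is_linear : linear comp_conj.
Proof.
move=> a x y; rewrite /comp_conj linearPl /= scalerBr scalerDl scalerA.
by rewrite opprD addrACA.
Qed.
HB.instance Definition _ :=
  GRing.isLinear.Build F C C *:%R comp_conj comp_conj_is_linear.

Definition skew : {vspace C} := lker (linfun comp_conj + \1)%VF.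

Lemma memv_skew x : (x \in skew) = (comp_conj x == - x).
Proof. by rewrite memv_ker !lfunE /= !lfunE /= addr_eq0. Qed.

Lemma memv_skewE x : (x \in skew) = (comp_polar x one == 0).
Proof.
rewrite memv_skew /comp_conj -subr_eq0 opprK subrK scaler_eq0.
have [one0|_] := eqVneq one 0; last by rewrite orbF.
by rewrite one0 linear0r eqxx orbT.
Qed.

Fact polarC (x y : C) : comp_polar x y = comp_polar y x.
Proof. by rewrite /comp_polar (addrC x) addrAC. Qed.

Fact polarMl (x y z : C) :
  comp_polar (x ** y) (x ** z) = comp_norm x * comp_polar y z.
Proof. by rewrite /comp_polar -linearDr !comp_normM -!mulrBr. Qed.

Fact polarM1 (x y : C) :
  comp_polar (x ** y) one = comp_polar x one * comp_polar y one - comp_polar x y.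
Proof.
have E1 := polarMl (x + one) y one.
have E2 := polarMl x y one.
have E3 := polarMl one y one.
have E4 : comp_norm (x + one) = comp_polar x one + comp_norm x + comp_norm one.
  by rewrite /comp_polar; ring.
rewrite comp_mulr1 in E2; rewrite !comp_mul1l in E3.
rewrite comp_mulr1 linearDl comp_mul1l !linearDr !linearDl /= in E1.
rewrite E2 E4 (polarC y x) in E1; clear E2 E4.
move: (comp_polar (x ** y) one) (comp_polar x y) (comp_polar x one)
  (comp_polar y one) (comp_norm x) (comp_norm one) E1 E3 => a b c d e f E1 E3.
have -> : a = (e * d + b + (a + d)) - (e * d + b + d) by ring.
by rewrite E1 !mulrDl -E3; ring.
Qed.

Lemma skew_comm_closed : @mul_closed F (commA C) skew.
Proof.
move=> x y _ _; rewrite memv_skewE /= /comm_mul linearBl /= !polarM1.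
by rewrite (polarC y x) mulrC subrr.
Qed.

End Skew.

Section TensorSquare.
Variables (F : fieldType) (C : compositionAlgebra F).
Local Notation one := (comp_one C).

Definition CC : nalgebra F := tensA C C.

Definition tensl (x : C) : CC := tens x one.
Definition tensr (x : C) : CC := tens one x.

Fact tensl_is_linear : linear tensl.
Proof. by move=> a x y; rewrite /tensl linearPl. Qed.
HB.instance Definition _ :=
  GRing.isLinear.Build F C CC *:%R tensl tensl_is_linear.

Fact tensr_is_linear : linear tensr.
Proof. by move=> a x y; rewrite /tensr linearPr. Qed.
HB.instance Definition _ :=
  GRing.isLinear.Build F C CC *:%R tensr tensr_is_linear.

(* C_0 (x) F1, F1 (x) C_0 and their sum S. *)
Definition leftv : {vspace CC} := (linfun tensl @: skew C)%VS.
Definition rightv : {vspace CC} := (linfun tensr @: skew C)%VS.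
Definition skewv : {vspace CC} := (leftv + rightv)%VS.

Lemma leftvP t : reflect (exists2 x, x \in skew C & t = tens x one) (t \in leftv).
Proof.
by apply: (iffP memv_imgP) => -[x Sx ->]; exists x; rewrite ?lfunE.
Qed.

Lemma rightvP t : reflect (exists2 x, x \in skew C & t = tens one x) (t \in rightv).
Proof.
by apply: (iffP memv_imgP) => -[x Sx ->]; exists x; rewrite ?lfunE.
Qed.

Lemma comm_tensl x y : comm_mul (tensl x) (tensl y) = tensl (comm_mul x y).
Proof. by rewrite /comm_mul !tens_mulE !comp_mul1l /= -linearBl. Qed.

Lemma comm_tensr x y : comm_mul (tensr x) (tensr y) = tensr (comm_mul x y).
Proof. by rewrite /comm_mul !tens_mulE !comp_mul1l /= -linearBr. Qed.

Lemma comm_tenslr x y : comm_mul (tensl x) (tensr y) = 0.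
Proof.
by rewrite /comm_mul !tens_mulE !comp_mul1l !comp_mulr1 subrr.
Qed.

Lemma comm_tensrl x y : comm_mul (tensr x) (tensl y) = 0.
Proof.
by rewrite /comm_mul !tens_mulE !comp_mul1l !comp_mulr1 subrr.
Qed.

Lemma leftv_closed : @mul_closed F (commA CC) leftv.
Proof.
move=> _ _ /leftvP[x Sx ->] /leftvP[y Sy ->] /=.
rewrite [X in X \in _]comm_tensl; apply/leftvP; exists (comm_mul x y) => //.
exact: skew_comm_closed.
Qed.

Lemma rightv_closed : @mul_closed F (commA CC) rightv.
Proof.
move=> _ _ /rightvP[x Sx ->] /rightvP[y Sy ->] /=.
rewrite [X in X \in _]comm_tensr; apply/rightvP; exists (comm_mul x y) => //.
exact: skew_comm_closed.
Qed.

Lemma skewv_closed : @mul_closed F (commA CC) skewv.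
Proof.
move=> ? ? /memv_addP[_ /leftvP[x Sx ->] [_ /rightvP[y Sy ->] ->]].
move=> /memv_addP[_ /leftvP[z Sz ->] [_ /rightvP[w Sw ->] ->]].
rewrite !linearDl !linearDr /= [X in _ + X + _]comm_tenslr.
rewrite [X in _ + (X + _)]comm_tensrl addr0 add0r.
apply: memv_add; [apply: leftv_closed|apply: rightv_closed].
- by apply/leftvP; exists x.
- by apply/leftvP; exists z.
- by apply/rightvP; exists y.
- by apply/rightvP; exists w.
Qed.

Definition leftA : nalgebra F := subA leftv_closed.
Definition rightA : nalgebra F := subA rightv_closed.
Definition skewA : nalgebra F := subA skewv_closed.

Definition left_ideal : {vspace skewA} := restrv skewv_closed leftv.
Definition right_ideal : {vspace skewA} := restrv skewv_closed rightv.

End TensorSquare.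

(* The grading group G is abelian and written additively. *)
Section Gradings.
Variables (F : fieldType) (G : zmodType).

Definition is_grading (A : nalgebra F) (Gam : G -> {vspace A}) : Prop :=
  [/\ forall s : seq G, uniq s -> directv (\sum_(g <- s) Gam g),
      exists s : seq G, (\sum_(g <- s) Gam g)%VS = fullv
    & forall g h x y, x \in Gam g -> y \in Gam h -> x ** y \in Gam (g + h)].

Definition graded_iso (A B : nalgebra F)
    (Gam : G -> {vspace A}) (Del : G -> {vspace B}) : Prop :=
  exists f : 'Hom(A, B),
    [/\ bijective f, forall x y, f (x ** y) = f x ** f y
      & forall g, (f @: Gam g)%VS = Del g].

Definition is_graded_ideal (A : nalgebra F) (Gam : G -> {vspace A})
    (I : {vspace A}) : Prop :=
  (forall x y, y \in I -> x ** y \in I /\ y ** x \in I) /\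
  (exists s : seq G, I = (\sum_(g <- s) (I :&: Gam g))%VS).

Definition graded_simple (A : nalgebra F) (Gam : G -> {vspace A}) : Prop :=
  (exists x y : A, x ** y != 0) /\
  (forall I, is_graded_ideal Gam I -> I = 0%VS \/ I = fullv).

Definition prod_grading (A B : nalgebra F)
    (Gam : G -> {vspace A}) (Del : G -> {vspace B}) (g : G) :
    {vspace prodA A B} := prodv (Gam g) (Del g).

Definition induced_grading (C : compositionAlgebra F)
    (Gam : G -> {vspace CC C}) (g : G) : {vspace skewA C} :=
  restrv (@skewv_closed F C) (Gam g).

End Gradings.

(* Main.v *)
(* Let S be the space of skew elements of C (x) C, n the norm of C and C_0 its
   space of skew elements.

   For x, y in C_0 one has [x, [x, y]] = 2 n(x, y) x - 4 n(x) y and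
   n([x, y]) = 4 n(x) n(y) - n(x, y)^2. Hence C_0 is simple under the commutator
   and its commutator algebra determines n, so that automorphisms of C_0 extend
   to C.

   S is determined by the product of C (x) C: the elements t with
   (t, x, y) = - (x, t, y) for all x, y form C (x) 1 + 1 (x) C, because only
   the multiples of 1 lie in the nucleus of C, or commute with all of C; and S is
   spanned by the commutators of such elements. These conditions are
   multilinear, so S is preserved by every automorphism and is a graded subspace
   for every grading.

   Therefore S = (C_0 (x) 1) + (1 (x) C_0) is a product of two simple algebras
   with no other proper ideals, each of them the annihilator of the other, which
   gives (1); its automorphisms are alpha x beta, possibly followed by the swap,
   and extend to C (x) C, which is spanned by S and S S, which gives (2). *)

Require Import Defs.
From HB Require Import structures.
From mathcomp Require Import all_boot all_order all_algebra.
From mathcomp Require Import ring.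
From Stdlib Require Import Classical.

Set Implicit Arguments.
Unset Strict Implicit.
Unset Printing Implicit Defensive.

Import GRing.Theory.
Local Open Scope ring_scope.
Local Open Scope nalg_scope.

(** * Composition algebras *)

(** No basis or multiplication table of C is used: the identities come from the nondegenerate
    multiplicative norm, and auxiliary vectors come from orthogonality and a count of dimensions.
    Among the integers only 2 and 4 are inverted, so characteristic 3, where C_0 is a Lie algebra,
    is not a separate case. The main obstacle is that [induced_grading] merely intersects the
    components with S, so that the gradedness of S has to be proved, while C (x) C is not
    alternative. The condition on t is linear in t. Testing it with some y (x) 1 in the last place
    turns it, on a pure tensor a (x) b, into an associator of a tensored with a commutator of b; the
    solutions are then found by linear algebra. *)

Section Composition.
Variables (F : fieldType) (C : compositionAlgebra F).
Hypothesis two_neq0 : 2%:R != 0 :> F.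
Local Notation one := (comp_one C).
Local Notation n := (@comp_norm F C).
Local Notation pol := (@comp_polar F C).
Implicit Types (x y z w a b : C).

Lemma polar_inj x y : (forall z, pol x z = pol y z) -> x = y.
Proof.
move=> E; apply/eqP; rewrite -subr_eq0; apply/eqP.
by apply: comp_polar_nondegenerate => z; rewrite linearBl /= E subrr.
Qed.

Lemma exists_polar_neq0 x : x != 0 -> exists z, pol x z != 0.
Proof.
move=> x0; apply: NNPP => H; case/eqP: x0.
apply: comp_polar_nondegenerate => z; apply/eqP/negPn/negP => xz.
by apply: H; exists z.
Qed.

(* Linear identities in C are proved by pairing both sides with a variable
   vector, which turns them into identities in F. *)
Ltac by_polar := apply: polar_inj => ? /=;
  rewrite ?(linearDl, linearBl, linearZl_LR, linearNl, linear0l,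
            linearDr, linearBr, linearZr_LR, linearNr, linear0r) /=; ring.

Lemma comp_normD x y : n (x + y) = n x + n y + pol x y.
Proof. by rewrite /comp_polar; ring. Qed.

Lemma polar_diag x : pol x x = 2%:R * n x.
Proof.
by rewrite /comp_polar -mulr2n -scaler_nat comp_normZ; ring.
Qed.

(** Full polarization of n(xy) = n(x) n(y): [polarMl] is already polarized in the second factor and
    is applied here to x + z. *)
Lemma polar_mul2 x y z w :
  pol (x ** y) (z ** w) + pol (x ** w) (z ** y) = pol x z * pol y w.
Proof.
have := polarMl (x + z) y w.
rewrite !linearDl !linearDr /= !polarMl comp_normD.
rewrite (polarC (z ** y)) => E.
by apply: (addrI (n x * pol y w + n z * pol y w)); rewrite -mulrDl -mulrDl -E; ring.
Qed.

(** This is [polar_mul2] with 1 in the third place: the adjoint of left multiplication by x is left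
    multiplication by the conjugate of x. *)
Lemma polar_adjl x y z : pol (x ** y) z = pol y (comp_conj x ** z).
Proof.
have := polar_mul2 x y one z; rewrite !comp_mul1l => E.
rewrite linearBl linearZl_LR /= linearBr linearZr_LR /= comp_mul1l -E.
by rewrite (polarC y (x ** z)); ring.
Qed.

Lemma conj_mulK x y : comp_conj x ** (x ** y) = n x *: y.
Proof.
apply: polar_inj => z.
by rewrite polarC -polar_adjl polarMl linearZl_LR /= polarC.
Qed.

Lemma comp_norm_aniso x : x != 0 -> exists z, n z != 0.
Proof.
case/exists_polar_neq0=> z xz; apply: NNPP => H.
have n0 u : n u = 0 by apply/eqP/negPn/negP => nu; apply: H; exists u.
by case/eqP: xz; rewrite /comp_polar !n0 !subr0.
Qed.

(** The nonzero x excludes the zero algebra, whose unit has norm 0. *)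
Lemma norm_one x : x != 0 -> n one = 1.
Proof.
case/comp_norm_aniso=> z nz; apply: (mulIf nz).
by rewrite -comp_normM comp_mul1l mul1r.
Qed.

Lemma polar_comm_one x y : pol (comm_mul x y) one = 0.
Proof. by rewrite linearBl /= !polarM1 (polarC y x) mulrC subrr. Qed.

Lemma comm_mulN x y : comm_mul x y = - comm_mul y x.
Proof. by rewrite /comm_mul opprB. Qed.

Lemma comm_mul_one x : comm_mul x one = 0.
Proof. by rewrite /comm_mul comp_mul1l comp_mulr1 subrr. Qed.

Lemma comm_one_mul x : comm_mul one x = 0.
Proof. by rewrite comm_mulN comm_mul_one oppr0. Qed.

Lemma conj_skew x : pol x one = 0 -> comp_conj x = - x.
Proof. by rewrite /comp_conj => ->; rewrite scale0r sub0r. Qed.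

Lemma skew_mulKl x z : pol x one = 0 -> x ** (x ** z) = - n x *: z.
Proof. by move=> Sx; rewrite scaleNr -conj_mulK conj_skew // linearNl opprK. Qed.

Lemma skew_sqr x : pol x one = 0 -> x ** x = - n x *: one.
Proof. by move=> Sx; rewrite -{2}[x]comp_mulr1 skew_mulKl. Qed.

Lemma skewD x y : pol x one = 0 -> pol y one = 0 -> pol (x + y) one = 0.
Proof. by move=> Sx Sy; rewrite linearDl /= Sx Sy addr0. Qed.

Lemma skew_mull2 x y z : pol x one = 0 -> pol y one = 0 ->
  x ** (y ** z) + y ** (x ** z) = - pol x y *: z.
Proof.
move=> Sx Sy; have := skew_mulKl z (skewD Sx Sy).
rewrite !linearDl !linearDr /= !skew_mulKl // comp_normD => E.
(* The polarized identity is solved for one product, because [by_polar] can use linearity only. *)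
have {E} -> : x ** (y ** z) = - (n x + n y + pol x y) *: z + n x *: z + n y *: z
    - y ** (x ** z).
  rewrite -E; by_polar.
by_polar.
Qed.

Lemma skew_anticomm x y : pol x one = 0 -> pol y one = 0 ->
  y ** x = - pol x y *: one - x ** y.
Proof.
move=> Sx Sy; have := skew_mull2 one Sx Sy; rewrite !comp_mulr1 => <-.
by rewrite addrC addKr.
Qed.

Lemma skew_mulE x y : pol x one = 0 -> pol y one = 0 ->
  comm_mul x y = 2%:R *: (x ** y) + pol x y *: one.
Proof. by move=> Sx Sy; rewrite /comm_mul (skew_anticomm Sx Sy); by_polar. Qed.

Lemma polar_skew_comm x y : pol x one = 0 -> pol y one = 0 ->
  pol x (comm_mul x y) = 0.
Proof.
move=> Sx Sy; rewrite skew_mulE // linearDr !linearZr_LR /= Sx -{1}[x]comp_mulr1.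
by rewrite polarMl (polarC one) Sy; ring.
Qed.

(** Since [x, y] is orthogonal to 1 and to x, the double commutator is 2 x [x, y]; substituting
    [x, y] = 2 xy + n(x, y) 1 and x(xy) = - n(x) y gives the formula. *)
Lemma double_comm x y : pol x one = 0 -> pol y one = 0 ->
  comm_mul x (comm_mul x y) = (2%:R * pol x y) *: x - (4%:R * n x) *: y.
Proof.
move=> Sx Sy; rewrite skew_mulE ?polar_comm_one // polar_skew_comm //.
rewrite skew_mulE // linearDr !linearZr_LR /= comp_mulr1 skew_mulKl //; by_polar.
Qed.

Lemma norm_comm x y : pol x one = 0 -> pol y one = 0 ->
  n (comm_mul x y) = 4%:R * n x * n y - pol x y ^+ 2.
Proof.
(* For x = 0 no nonzero vector is at hand to give n(1) = 1. *)
move=> Sx Sy; have [->|x0] := eqVneq x 0.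
  by rewrite !linear0l /= -(scale0r (0 : C)) comp_normZ; ring.
rewrite skew_mulE // comp_normD !comp_normZ comp_normM (norm_one x0).
rewrite linearZl_LR linearZr_LR /= polarM1 Sx Sy; ring.
Qed.

(** * The quadratic equation and left alternativity *)

Lemma sqrE x : x ** x = pol x one *: x - n x *: one.
Proof.
have := conj_mulK x one; rewrite comp_mulr1 /comp_conj.
by rewrite linearBl linearZl_LR /= comp_mul1l => <-; rewrite opprB addrC subrK.
Qed.

Lemma left_alternative x y : x ** (x ** y) = (x ** x) ** y.
Proof.
rewrite sqrE linearBl !linearZl_LR /= comp_mul1l -conj_mulK /comp_conj.
by rewrite linearBl linearZl_LR /= comp_mul1l opprB addrC subrK.
Qed.

(** Linearization of x(xy) = (xx)y: the associator is skew-symmetric in its first two arguments. *)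
Lemma left_alternative2 x y z :
  (x ** y) ** z - x ** (y ** z) + ((y ** x) ** z - y ** (x ** z)) = 0.
Proof.
have := left_alternative (x + y) z.
rewrite !linearDl !linearDr /= !linearDl /= !left_alternative => E.
have {E} -> : x ** (y ** z) = x ** x ** z + x ** y ** z + (y ** x ** z + y ** y ** z)
   - x ** x ** z - (y ** (x ** z) + y ** y ** z) by rewrite -E; by_polar.
by_polar.
Qed.

(** * Anisotropic skew vectors and simplicity of C_0 *)

Lemma exists_orthogonal (s : seq C) : (size s < \dim {:C})%N ->
  exists2 d, d != 0 & forall i, i \in s -> pol d i = 0.
Proof.
move=> lt_s; pose f d : 'rV[F]_(size s) := \row_i pol d s`_i.
have lin_f : linear f by move=> a x y; apply/rowP => i; rewrite !mxE linearPl.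
pose fL : {linear C -> 'rV[F]_(size s)} :=
  HB.pack f (GRing.isLinear.Build F C 'rV[F]_(size s) *:%R f lin_f).
have ker0 : lker (linfun fL) != 0%VS.
  apply/eqP => k0; have := limg_ker_dim (linfun fL) fullv.
  rewrite k0 capv0 dimv0 => E; move: lt_s; rewrite -E add0n ltnNge => /negP; apply.
  by apply: leq_trans (dimvS (subvf _)) _; rewrite dimvf dim_matrix mul1r.
exists (vpick (lker (linfun fL))); first by rewrite vpick0.
move=> _ /(nthP 0)[i lti <-].
have := memv_pick (lker (linfun fL)); rewrite memv_ker lfunE /= => /eqP.
by move/rowP/(_ (Ordinal lti)); rewrite !mxE.
Qed.

(** The plane spanned by 1 and a is nondegenerate because n(a) is nonzero, so its orthogonal
    complement contains w and z' with n(w, z') nonzero. If n(w) = n(z') = 0, then n(w + z') = n(w,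
    z'). *)
Lemma skew_orth_aniso a : (2 < \dim {:C})%N -> pol a one = 0 -> n a != 0 ->
  exists b, [/\ pol b one = 0, pol b a = 0 & n b != 0].
Proof.
move=> dimC Sa na; have [w w0 Hw] := @exists_orthogonal [:: one; a] dimC.
have [z wz] := exists_polar_neq0 w0.
have w1 : pol w one = 0 by apply: Hw; rewrite !inE eqxx.
have wa : pol w a = 0 by apply: Hw; rewrite !inE eqxx orbT.
pose z' := z - (2%:R^-1 * pol z one) *: one - (2%:R^-1 * (n a)^-1 * pol z a) *: a.
have z1 : pol z' one = 0.
  rewrite !linearBl !linearZl_LR /= polar_diag (norm_one w0) Sa; field.
  by rewrite na two_neq0.
have za : pol z' a = 0.
  rewrite !linearBl !linearZl_LR /= polar_diag (polarC one a) Sa; field.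
  by rewrite na two_neq0.
have wz' : pol w z' != 0.
  by rewrite !linearBr !linearZr_LR /= w1 wa !mulr0 !subr0.
clearbody z'; have [nw|nw] := eqVneq (n w) 0; last by exists w.
have [nz|nz] := eqVneq (n z') 0; last by exists z'.
exists (w + z'); rewrite !linearDl /= w1 z1 wa za !addr0; split=> //.
by rewrite comp_normD nw nz !add0r.
Qed.

Lemma exists_skew_aniso : (1 < \dim {:C})%N -> exists2 a, pol a one = 0 & n a != 0.
Proof.
move=> dimC; have [w w0 Hw] := @exists_orthogonal [:: one] dimC.
have w1 : pol w one = 0 by apply: Hw; rewrite !inE eqxx.
have [z wz] := exists_polar_neq0 w0.
pose z' := z - (2%:R^-1 * pol z one) *: one.
have z1 : pol z' one = 0.
  rewrite !linearBl !linearZl_LR /= polar_diag (norm_one w0); by field.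
have wz' : pol w z' != 0 by rewrite linearBr linearZr_LR /= w1 mulr0 subr0.
clearbody z'; have [nw|nw] := eqVneq (n w) 0; last by exists w.
have [nz|nz] := eqVneq (n z') 0; last by exists z'.
exists (w + z'); first by rewrite linearDl /= w1 z1 addr0.
by rewrite comp_normD nw nz !add0r.
Qed.

Lemma four_neq0 : 4%:R != 0 :> F.
Proof. by rewrite (natrM _ 2 2) mulf_neq0. Qed.

(** Both cases are read off n([a, b]) = 4 n(a) n(b) - n(a, b)^2: if n(a) is nonzero, b is
    anisotropic and orthogonal to a; if n(a) = 0, b is not orthogonal to a. *)
Lemma exists_comm_aniso a : (2 < \dim {:C})%N -> pol a one = 0 -> a != 0 ->
  exists2 b, pol b one = 0 & n (comm_mul a b) != 0.
Proof.
move=> dimC Sa a0; have [na|na] := eqVneq (n a) 0; last first.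
  have [b [Sb ba nb]] := skew_orth_aniso dimC Sa na.
  exists b => //; rewrite norm_comm // polarC ba expr0n subr0.
  by rewrite !mulf_neq0 // four_neq0.
have [z az] := exists_polar_neq0 a0.
pose z' := z - (2%:R^-1 * pol z one) *: one.
have z1 : pol z' one = 0.
  rewrite !linearBl !linearZl_LR /= polar_diag (norm_one a0); by field.
exists z' => //; rewrite norm_comm // na mulr0 mul0r sub0r oppr_eq0 expf_neq0 //.
by rewrite linearBr linearZr_LR /= Sa mulr0 subr0.
Qed.

(** If P contains an anisotropic z, then [double_comm] solved for y writes every skew y through [z,
    [z, y]] and z. Any nonzero x in P has an anisotropic commutator, which supplies z. *)
Lemma skew_simple (P : C -> Prop) : (2 < \dim {:C})%N ->
  (forall c x y, P x -> P y -> P (c *: x + y)) ->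
  (forall x y, pol x one = 0 -> pol y one = 0 -> P x -> P (comm_mul x y)) ->
  forall x, pol x one = 0 -> P x -> x != 0 -> forall y, pol y one = 0 -> P y.
Proof.
move=> dimC Plin Pcomm.
have aniso z y : pol z one = 0 -> P z -> n z != 0 -> pol y one = 0 -> P y.
  move=> Sz Pz nz Sy; pose t := comm_mul z (comm_mul z y).
  have P0 : P 0 by have := Plin (-1) z z Pz Pz; rewrite scaleN1r addNr.
  have -> : y = - (4%:R * n z)^-1 *: t + ((2%:R * n z)^-1 * pol z y *: z + 0).
    rewrite /t double_comm // addr0; apply: polar_inj => u.
    rewrite linearDl !linearZl_LR /= linearBl !linearZl_LR /=; field.
    by rewrite nz two_neq0 four_neq0.
  apply: (Plin _ t); last exact: (Plin _ z).
  rewrite /t comm_mulN -scaleN1r -[_ *: _]addr0; apply: Plin P0.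
  by apply: (Pcomm); rewrite ?polar_comm_one //; apply: (Pcomm).
move=> x Sx Px x0 y Sy; have [b Sb nb] := exists_comm_aniso dimC Sx x0.
by apply: (aniso (comm_mul x b)) => //; [apply: polar_comm_one | apply: Pcomm].
Qed.

(** By [double_comm], y is a multiple of [a, [a, y]] plus a multiple of a, and a is a multiple of
    [b, [b, a]] when b is orthogonal to a. *)
Lemma skew_sum_comm : (2 < \dim {:C})%N -> exists a b, forall y, pol y one = 0 ->
  exists y1 y2, y = comm_mul a y1 + comm_mul b y2.
Proof.
move=> dimC; have [a Sa na] := exists_skew_aniso (ltnW dimC).
have [b [Sb ba nb]] := skew_orth_aniso dimC Sa na.
exists a, b => y Sy.
exists (- (4%:R * n a)^-1 *: comm_mul a y).
exists (- (4%:R * n b)^-1 * (2%:R * n a)^-1 * pol a y *: comm_mul b a).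
rewrite !linearZr_LR /= !double_comm // ba; apply: polar_inj => u.
rewrite linearDl !linearZl_LR /= !linearBl !linearZl_LR /=; field.
by rewrite na nb two_neq0 four_neq0.
Qed.

Lemma center_skew x : (2 < \dim {:C})%N -> pol x one = 0 ->
  (forall y, comm_mul x y = 0) -> x = 0.
Proof.
move=> dimC Sx Hx; apply/eqP/negPn/negP => x0.
have [b Sb] := exists_comm_aniso dimC Sx x0.
by rewrite Hx -(scale0r (0 : C)) comp_normZ expr0n mul0r eqxx.
Qed.

(* If a is in the nucleus and d is orthogonal to 1, a, b, ab, then d both commutes
   and anticommutes with [a, b], which is invertible for a suitable b. *)
Lemma nucleus_skew a : (4 < \dim {:C})%N -> pol a one = 0 ->
  (forall x y, (a ** x) ** y = a ** (x ** y)) -> a = 0.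
Proof.
move=> dimC Sa Ha; apply/eqP/negPn/negP => a0.
have [b Sb nc] := exists_comm_aniso (ltnW (ltnW dimC)) Sa a0.
have [d d0 Hd] := @exists_orthogonal [:: one; a; b; a ** b] dimC.
have Sd : pol d one = 0 by apply: Hd; rewrite !inE eqxx.
have da : pol d a = 0 by apply: Hd; rewrite !inE eqxx !orbT.
have db : pol d b = 0 by apply: Hd; rewrite !inE eqxx !orbT.
have dc : pol d (a ** b) = 0 by apply: Hd; rewrite !inE eqxx !orbT.
have anti u v : pol u one = 0 -> pol v one = 0 -> pol u v = 0 -> u ** v = - (v ** u).
  by move=> Su Sv uv; rewrite (skew_anticomm Sv Su) polarC uv oppr0 scale0r sub0r.
(* The chain is d(ab) = (da)b = -(ad)b = -a(db) = a(bd) = (ab)d; its first equality is linearized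
   left alternativity, in which the associator (a, d, b) vanishes. *)
have dab : d ** (a ** b) = (a ** b) ** d.
  have /eqP := left_alternative2 d a b; rewrite Ha subrr addr0 subr_eq0 => /eqP <-.
  by rewrite (anti d a) // linearNl Ha (anti d b) // linearNr opprK Ha.
have c0 : comm_mul (comm_mul a b) d = 0.
  rewrite comm_mulN (skew_mulE Sa Sb) linearDr !linearZr_LR /= comm_mul_one.
  by rewrite /comm_mul dab subrr !scaler0 addr0 oppr0.
have := double_comm (polar_comm_one a b) Sd; rewrite c0 linear0r /=.
rewrite (polarC _ d) {1}skew_mulE // linearDr !linearZr_LR /= dc Sd !mulr0 addr0 mulr0.
rewrite scale0r sub0r => /eqP; rewrite eq_sym oppr_eq0 scaler_eq0 (negPf d0) orbF.
by rewrite mulf_eq0 (negPf four_neq0) (negPf nc).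
Qed.
(** An anisotropic y is not a multiple of an isotropic x; if x is anisotropic, y is moreover taken
    orthogonal to it. *)
Lemma exists_skew_indep x : (2 < \dim {:C})%N -> pol x one = 0 ->
  exists2 y, pol y one = 0 & forall c, y != c *: x.
Proof.
move=> dimC Sx; have [nx|nx] := eqVneq (n x) 0.
  have [y Sy ny] := exists_skew_aniso (ltnW dimC); exists y => // c.
  by apply: contraNneq ny => ->; rewrite comp_normZ nx mulr0.
have [y [Sy yx ny]] := skew_orth_aniso dimC Sx nx.
exists y => // c; apply: contraNneq ny => yE; move: yx.
rewrite yE linearZl_LR /= polar_diag => /eqP; rewrite !mulf_eq0 (negPf nx).
by rewrite (negPf two_neq0) !orbF => /eqP ->; rewrite comp_normZ expr0n mul0r.
Qed.

(** * Extending an automorphism of C_0 to C *)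

Section SkewAutomorphism.
Hypothesis dimC : (2 < \dim {:C})%N.
Variable phi : {linear C -> C}.
Hypotheses (phi_skew : forall x, pol x one = 0 -> pol (phi x) one = 0)
  (phi_inj : forall x, pol x one = 0 -> phi x = 0 -> x = 0)
  (phi_comm : forall x y, pol x one = 0 -> pol y one = 0 ->
     phi (comm_mul x y) = comm_mul (phi x) (phi y)).

(* [x, [x, y]] = 2 n(x, y) x - 4 n(x) y determines n(x) as soon as y is not a
   multiple of x. *)
Lemma skew_aut_norm x : pol x one = 0 -> n (phi x) = n x.
Proof.
move=> Sx; have [y Sy Hy] := exists_skew_indep dimC Sx.
have := congr1 phi (double_comm Sx Sy).
rewrite !phi_comm ?polar_comm_one // double_comm ?phi_skew //.
rewrite linearB ![phi (_ *: _)]linearZ /= => E.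
apply/eqP; rewrite -subr_eq0; apply/negPn/negP => nz.
(* The equation E says that 4 (n(phi x) - n(x)) phi y is 2 (n(phi x, phi y) - n(x, y)) phi x;
   dividing gives phi y = k phi x, against the choice of y. *)
pose k := 2%:R * (pol (phi x) (phi y) - pol x y) / (4%:R * (n (phi x) - n x)).
case/negP: (Hy k); rewrite -subr_eq0; apply/eqP/phi_inj.
  by rewrite linearBl linearZl_LR /= Sx Sy mulr0 subr0.
rewrite linearB linearZ /=; apply: polar_inj => u.
have := congr1 (pol^~ u) E; rewrite !linearBl !linearZl_LR linear0l /= => {}E.
have -> : pol (phi y) u = (4%:R * (n (phi x) - n x))^-1 *
   (4%:R * n (phi x) * pol (phi y) u - 4%:R * n x * pol (phi y) u).
  by field; rewrite nz four_neq0.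
have -> : 4%:R * n x * pol (phi y) u = 2%:R * pol x y * pol (phi x) u -
  (2%:R * pol (phi x) (phi y) * pol (phi x) u - 4%:R * n (phi x) * pol (phi y) u).
  by rewrite E; ring.
by rewrite /k; field; rewrite nz four_neq0.
Qed.

Lemma skew_aut_polar x y : pol x one = 0 -> pol y one = 0 ->
  pol (phi x) (phi y) = pol x y.
Proof.
move=> Sx Sy; rewrite /comp_polar -linearD !skew_aut_norm //.
exact: skewD.
Qed.

Lemma skew_aut_mul x y : pol x one = 0 -> pol y one = 0 ->
  2%:R *: (phi x ** phi y) = phi (comm_mul x y) - pol x y *: one.
Proof.
move=> Sx Sy; rewrite phi_comm // skew_mulE ?phi_skew // skew_aut_polar //.
by rewrite addrK.
Qed.

(** As n(1, 1) = 2, this is the coefficient of 1 in the decomposition of C into F1 and C_0; [ext] is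
    the identity on F1 and [phi] on C_0. *)
Let tau x : F := 2%:R^-1 * pol x one.
Let ext x : C := tau x *: one + phi (x - tau x *: one).

Fact skew_ext_linear : linear ext.
Proof.
move=> a x y; rewrite /ext !linearB !linearZ !linearD !linearZ /= /tau.
rewrite linearDl linearZl_LR /=; by_polar.
Qed.

(** On C_0 the product satisfies 2 xy = [x, y] - n(x, y) 1, and both terms on the right are
    respected: the commutator by assumption, the form by [skew_aut_polar]. *)
Lemma skew_automorphism_ext : exists2 alpha : {linear C -> C},
  (forall x, pol x one = 0 -> alpha x = phi x) &
  [/\ alpha one = one, injective alpha &
      forall x y, alpha (x ** y) = alpha x ** alpha y].
Proof.
have [alpha alphaE] : exists alpha : {linear C -> C}, alpha =1 ext.
  pose ext_lin := GRing.isLinear.Build F C C *:%R ext skew_ext_linear.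
  by exists (HB.pack_for {linear C -> C} ext ext_lin).
have [w w0 _] := @exists_orthogonal [::] (ltnW (ltnW dimC)).
have n1 := norm_one w0.
have alpha_skew x : pol x one = 0 -> alpha x = phi x.
  by move=> Sx; rewrite alphaE /ext /tau Sx mulr0 !scale0r add0r subr0.
have alpha1 : alpha one = one.
  rewrite alphaE /ext /tau polar_diag n1 mulr1 mulVf // scale1r subrr.
  by rewrite linear0 addr0.
have skew_part x : pol (x - tau x *: one) one = 0.
  by rewrite linearBl linearZl_LR /= polar_diag n1 /tau; field.
exists alpha => //; split=> //.
- move=> x y xy; apply/eqP; rewrite -subr_eq0; apply/eqP.
  have: alpha (x - y) = 0 by rewrite linearB xy subrr.
  move: (x - y) => {xy}z; rewrite alphaE /ext => zE.
  have t0 : tau z = 0.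
    have := congr1 (pol^~ one) zE; rewrite linearDl linearZl_LR linear0l /=.
    rewrite polar_diag n1 mulr1 phi_skew // addr0 => /eqP.
    by rewrite mulf_eq0 (negPf two_neq0) orbF => /eqP.
  move: zE (skew_part z); rewrite t0 !scale0r add0r subr0 => zE Sz.
  exact: phi_inj.
have mul_skew x y : pol x one = 0 -> pol y one = 0 ->
    alpha (x ** y) = phi x ** phi y.
  move=> Sx Sy; apply: (scalerI two_neq0); rewrite -linearZ /=.
  rewrite skew_aut_mul // -alpha_skew ?polar_comm_one // skew_mulE //.
  by rewrite linearD ![alpha (_ *: _)]linearZ /= alpha1 addrK.
move=> x y; rewrite -[x](subrK (tau x *: one)) -[y](subrK (tau y *: one)).
move: (tau x) (tau y) (skew_part x) (skew_part y) => a b.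
move: (x - _) (y - _) => {}x {}y Sx Sy.
rewrite !(linearDl, linearZl_LR, linearDr, linearZr_LR) /=.
rewrite !comp_mul1l !comp_mulr1 !linearD !linearZ /= alpha1 mul_skew //.
rewrite !(linearDl, linearZl_LR, linearDr, linearZr_LR) /=.
rewrite !comp_mul1l !comp_mulr1 !alpha_skew // scalerDr !scalerA (mulrC a b).
by rewrite -!addrA; congr (_ + _); rewrite addrCA.
Qed.

End SkewAutomorphism.
End Composition.

(** * Gradings and their projections *)

Section GradedSpaces.
Variables (F : fieldType) (G : zmodType).

Section Projections.
Variables (V : vectType F) (Gam : G -> {vspace V}).

Lemma sumv_seq_ind (P : V -> Prop) (s : seq G) :
  P 0 -> (forall x y, P x -> P y -> P (x + y)) ->
  (forall g x, g \in s -> x \in Gam g -> P x) ->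
  forall x, x \in (\sum_(g <- s) Gam g)%VS -> P x.
Proof.
move=> P0 PD; elim: s => [|g s IHs] Ps x.
  by rewrite big_nil memv0 => /eqP ->.
rewrite big_cons => /memv_addP[y yg [z zs ->]]; apply: PD.
  by apply: (Ps g) => //; rewrite mem_head.
by apply: IHs zs => h w hs; apply: Ps; rewrite inE hs orbT.
Qed.

Lemma memv_sum_seq (s : seq G) g x :
  g \in s -> x \in Gam g -> x \in (\sum_(h <- s) Gam h)%VS.
Proof.
by move=> gs xg; rewrite (big_rem g) //=; apply: (subvP (addvSl _ _)).
Qed.

(** G may be infinite, so directness is about finite duplicate-free lists; comparing dimensions, one
    component at a time, turns it into trivial intersections. *)
Lemma directv_seqP :
  (forall s : seq G, uniq s -> directv (\sum_(g <- s) Gam g)) <->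
  (forall g (s : seq G), uniq s -> g \notin s ->
     (Gam g :&: \sum_(h <- s) Gam h)%VS = 0%VS).
Proof.
split=> [dirG g s us gs | capG].
  have us' : uniq (g :: s) by rewrite /= gs.
  have := directvP (dirG _ us'); rewrite /= !big_cons.
  have /= <- := directvP (dirG _ us) => dimE.
  apply/eqP; rewrite -dimv_eq0 -(eqn_add2l (\dim (Gam g + \sum_(h <- s) Gam h))).
  by rewrite dimv_sum_cap addn0 dimE.
elim=> [_|g s IHs] /=; first by apply/directvP; rewrite /= !big_nil dimv0.
case/andP=> gs us; apply/directvP; rewrite /= !big_cons dimv_disjoint_sum ?capG //.
by have /= -> := directvP (IHs us).
Qed.

(* [s] contains the support of the grading. *)
Record projections (s : seq G) (pi : G -> 'End(V)) : Prop := Projections {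
  proj_mem : forall g x, pi g x \in Gam g;
  proj_id : forall g x, x \in Gam g -> pi g x = x;
  proj_off : forall g h x, x \in Gam h -> g != h -> pi g x = 0;
  proj_sum : forall x, x = \sum_(g <- s) pi g x
}.

Lemma exists_projections :
  (forall s : seq G, uniq s -> directv (\sum_(g <- s) Gam g)) ->
  (exists s : seq G, (\sum_(g <- s) Gam g)%VS = fullv) ->
  exists s pi, uniq s /\ projections s pi.
Proof.
move=> /directv_seqP capG [s0 full0]; pose s := undup s0.
have us : uniq s := undup_uniq s0.
have fulls x : x \in (\sum_(g <- s) Gam g)%VS.
  have: x \in (\sum_(g <- s0) Gam g)%VS by rewrite full0 memvf.
  apply: (@sumv_seq_ind (fun x => x \in (\sum_(g <- s) Gam g)%VS)) => [|y z|g y gs yg].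
  - exact: mem0v.
  - exact: memvD.
  - by apply: memv_sum_seq yg; rewrite mem_undup.
(* A component off the list meets the sum over the list, which is everything, trivially. *)
have off0 g x : g \notin s -> x \in Gam g -> x = 0.
  move=> gs xg; apply/eqP; rewrite -memv0 -(capG g s us gs) memv_cap xg.
  exact: fulls.
pose rest g := (\sum_(h <- rem g s) Gam h)%VS.
have cap_rest g : (Gam g :&: rest g)%VS = 0%VS.
  by rewrite capG ?rem_uniq // mem_rem_uniq // inE eqxx.
pose pi g := daddv_pi (Gam g) (rest g).
have pi_off g h x : x \in Gam h -> g != h -> pi g x = 0.
  move=> xh gh; have [hs|hs] := boolP (h \in s); last first.
    by rewrite (off0 h x) ?linear0.
  have xr : x \in rest g.
    by apply: memv_sum_seq xh; rewrite mem_rem_uniq // inE eq_sym gh.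
  have := daddv_pi_add (cap_rest g) (subvP (addvSr (Gam g) _) _ xr).
  rewrite (daddv_pi_id _ xr) ?[(rest g :&: _)%VS]capvC //.
  by move=> /(canRL (addrK x)); rewrite subrr.
have pi_id g x : x \in Gam g -> pi g x = x.
  by move=> xg; rewrite /pi daddv_pi_id.
exists s, pi; split=> //; split=> // [g x|x]; first exact: memv_pi.
have := fulls x; move: x.
apply: (sumv_seq_ind (P := fun x => x = \sum_(g <- s) pi g x)) => [|x y Ex Ey|g x gs xg].
- by rewrite big1 // => g _; rewrite linear0.
- by rewrite {1}Ex {1}Ey -big_split; apply: eq_bigr => g _; rewrite linearD.
- rewrite (big_rem g) //= pi_id // big_seq big1 ?addr0 // => h.
  by rewrite mem_rem_uniq // inE => /andP[hg _]; apply: pi_off xg _.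
Qed.

Variables (s : seq G) (pi : G -> 'End(V)) (pr : projections s pi).

Lemma memv_proj_id g x : (x \in Gam g) <-> pi g x = x.
Proof. by split=> [/(proj_id pr)|<-] //; apply: proj_mem pr _ _. Qed.

Lemma graded_ind (P : V -> Prop) :
  P 0 -> (forall x y, P x -> P y -> P (x + y)) ->
  (forall g x, x \in Gam g -> P x) -> forall x, P x.
Proof.
move=> P0 PD Phom x; rewrite [x](proj_sum pr).
by apply: big_ind => // g _; apply: Phom (proj_mem pr g x).
Qed.

(** Replaces the existence of a list by stability under the projections, the form in which
    gradedness can be proved for S and for annihilators. *)
Lemma graded_subspaceP (U : {vspace V}) :
  (exists s' : seq G, U = (\sum_(g <- s') (U :&: Gam g))%VS) <->
  (forall g x, x \in U -> pi g x \in U).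
Proof.
split=> [[s' UE] g x|stabU].
  rewrite {1}UE; elim: s' {UE} x => [|h s' IHs] x.
    by rewrite big_nil memv0 => /eqP ->; rewrite linear0 mem0v.
  rewrite big_cons => /memv_addP[y /memv_capP[yU yh] [z zs ->]].
  rewrite linearD /=; apply: memvD (IHs _ zs); have [->|gh] := eqVneq g h.
    by rewrite (proj_id pr).
  by rewrite (proj_off pr yh) ?mem0v.
exists s; apply/eqP; rewrite eqEsubv; apply/andP; split; apply/subvP=> x xU.
  rewrite [x](proj_sum pr); elim: s => [|g s' IHs]; first by rewrite !big_nil mem0v.
  by rewrite !big_cons memv_add // memv_cap stabU // (proj_mem pr).
elim: s x xU => [|g s' IHs] x; first by rewrite big_nil memv0 => /eqP ->; apply: mem0v.
rewrite big_cons => /memv_addP[y /memv_capP[yU _] [z zs ->]].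
by apply: memvD (IHs _ zs).
Qed.

End Projections.

(** The projection to [Gam g] fixes the image of [Del g] and kills the images of the other
    components, so an element in both has image 0. *)
Lemma directv_sub (V W : vectType F) (Gam : G -> {vspace V}) (Del : G -> {vspace W})
    s pi (f : {linear W -> V}) : projections Gam s pi ->
  injective f -> (forall g x, x \in Del g -> f x \in Gam g) ->
  forall s' : seq G, uniq s' -> directv (\sum_(g <- s') Del g).
Proof.
move=> pr f_inj fDel; apply/directv_seqP => g s' us gs; apply/eqP.
rewrite -subv0; apply/subvP=> x /memv_capP[xg xs]; rewrite memv0; apply/eqP/f_inj.
rewrite linear0 -(proj_id pr (fDel _ _ xg)); move: xs {xg}.
elim: s' gs us x => [_ _ x|h s' IHs].
  by rewrite big_nil memv0 => /eqP ->; rewrite !linear0.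
rewrite inE negb_or => /andP[gh gs] /= /andP[_ us] x.
rewrite big_cons => /memv_addP[y yh [z zs ->]].
by rewrite !linearD /= (IHs gs us _ zs) (proj_off pr (fDel _ _ yh)) // addr0.
Qed.

Lemma proj_comm (V W : vectType F) (Gam : G -> {vspace V}) (Del : G -> {vspace W})
  s pi s' pi' (f : {linear V -> W}) :
  projections Gam s pi -> projections Del s' pi' ->
  (forall g x, x \in Gam g -> f x \in Del g) ->
  forall g x, f (pi g x) = pi' g (f x).
Proof.
move=> pr pr' fG g; apply: (graded_ind pr) => [|x y Ex Ey|h x xh].
- by rewrite !linear0.
- by rewrite !linearD Ex Ey.
- have [<-|gh] := eqVneq h g; first by rewrite (proj_id pr) // (proj_id pr') // fG.
  by rewrite (proj_off pr xh) 1?eq_sym // (proj_off pr' (fG _ _ xh)) 1?eq_sym ?linear0.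
Qed.

End GradedSpaces.

(** * Gradings of algebras and their isomorphisms *)

Section GradedAlgebras.
Variables (F : fieldType) (G : zmodType).
Implicit Types A B D : nalgebra F.

Lemma grading_projections A (Gam : G -> {vspace A}) : is_grading Gam ->
  exists s pi, projections Gam s pi.
Proof.
case=> dirG fullG _; have [s [pi [_ pr]]] := exists_projections dirG fullG.
by exists s, pi.
Qed.

Lemma grading_mul A (Gam : G -> {vspace A}) : is_grading Gam ->
  forall g h x y, x \in Gam g -> y \in Gam h -> x ** y \in Gam (g + h).
Proof. by case. Qed.

Section ProjMul.
Variables (A : nalgebra F) (Gam : G -> {vspace A}) (grG : is_grading Gam).
Variables (s : seq G) (pi : G -> 'End(A)) (pr : projections Gam s pi).

(** Right multiplication by an element of degree h translates degrees by h, and translation is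
    injective, so no other component of x contributes in degree g + h. *)
Lemma proj_mulr g h x y : y \in Gam h -> pi (g + h) (x ** y) = pi g x ** y.
Proof.
move=> yh; move: x; apply: (graded_ind pr) => [|x z Ex Ez|k x xk].
- by rewrite !(linear0, linear0l).
- by rewrite linearDl !linearD /= linearDl Ex Ez.
have xyk := grading_mul grG xk yh.
have [->|gk] := eqVneq g k; first by rewrite (proj_id pr xyk) (proj_id pr xk).
by rewrite (proj_off pr xyk) ?(proj_off pr xk) ?linear0l // (inj_eq (addIr h)).
Qed.

Lemma proj_mull g h x y : y \in Gam h -> pi (h + g) (y ** x) = y ** pi g x.
Proof.
move=> yh; move: x; apply: (graded_ind pr) => [|x z Ex Ez|k x xk].
- by rewrite !(linear0, linear0r).
- by rewrite linearDr !linearD /= Ex Ez.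
have xyk := grading_mul grG yh xk.
have [->|gk] := eqVneq g k; first by rewrite (proj_id pr xyk) (proj_id pr xk).
by rewrite (proj_off pr xyk) ?(proj_off pr xk) ?linear0r // (inj_eq (addrI h)).
Qed.

(** The element (pi g x)(pi h y) is the component of degree g + h of x (pi h y), which is 0 because
    pi h y stays in I. *)
Lemma annihilator_graded (I J : {vspace A}) :
  (forall x, x \in J <-> forall y, y \in I -> x ** y = 0 /\ y ** x = 0) ->
  (forall g x, x \in I -> pi g x \in I) -> forall g x, x \in J -> pi g x \in J.
Proof.
move=> annJ stI g x /annJ xJ; apply/annJ => y yI; rewrite [y](proj_sum pr).
rewrite linear_sumr linear_sumlz !big1 // => h _.
  by rewrite -(proj_mull _ _ (proj_mem pr h y)) (xJ _ (stI h _ yI)).2 linear0.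
by rewrite -(proj_mulr _ _ (proj_mem pr h y)) (xJ _ (stI h _ yI)).1 linear0.
Qed.

Lemma comm_grading : @is_grading F G (commA A) Gam.
Proof.
case: grG => dirG fullG mulG; split=> // g h x y xg yh.
apply: memvB; first exact: mulG.
(* The product yx has degree h + g, which is g + h because G is abelian. *)
by rewrite addrC; apply: mulG.
Qed.

Lemma sub_grading (U : {vspace A}) (clU : mul_closed U) :
  (forall g x, x \in U -> pi g x \in U) ->
  is_grading (fun g => restrv clU (Gam g)).
Proof.
move=> stabU; split=> [s' us'||g h x y].
- apply: (directv_sub (f := vsval : {linear subvs_of U -> A}) pr) us'.
    exact: subvs_inj.
  by move=> g x; rewrite memv_restrv.
- exists s; apply/eqP; rewrite eqEsubv subvf; apply/subvP => x _.
  have -> : x = \sum_(g <- s) vsproj U (pi g (vsval x)).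
    apply: subvs_inj; rewrite linear_sum /= [LHS](proj_sum pr).
    by apply: eq_bigr => g _; rewrite vsprojK // stabU ?subvsP.
  elim: (s) => [|g s' IHs]; first by rewrite !big_nil mem0v.
  rewrite !big_cons memv_add // memv_restrv vsprojK ?stabU ?subvsP //.
  exact: proj_mem pr _ _.
- rewrite !memv_restrv; exact: grading_mul.
Qed.

End ProjMul.

Lemma bijective_lfunVK (V W : vectType F) (f : 'Hom(V, W)) :
  bijective f -> cancel f f^-1%VF /\ cancel f^-1%VF f.
Proof.
move=> bf; have ker0 : lker f == 0%VS by apply/lker0P/bij_inj.
have fK := lker0_lfunK ker0; split=> // y.
by case: bf => g _ gK; rewrite -[y]gK fK.
Qed.

Lemma graded_iso_mem A B (Gam : G -> {vspace A}) (Del : G -> {vspace B}) :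
  graded_iso Gam Del <-> exists f : 'Hom(A, B),
    [/\ bijective f, forall x y, f (x ** y) = f x ** f y
      & forall g x, (f x \in Del g) = (x \in Gam g)].
Proof.
split=> -[f [bf fM fG]]; exists f; split=> // g.
  move=> x; rewrite -fG; apply/idP/idP; last exact: memv_img.
  by case/memv_imgP=> y yg /(bij_inj bf) ->.
apply/vspaceP => y; apply/idP/idP.
  by case/memv_imgP=> x xg ->; rewrite fG.
have [_ fVK] := bijective_lfunVK bf; rewrite -{1}[y]fVK fG => yg.
by rewrite -[y]fVK memv_img.
Qed.

Lemma graded_iso_sym A B (Gam : G -> {vspace A}) (Del : G -> {vspace B}) :
  graded_iso Gam Del -> graded_iso Del Gam.
Proof.
move=> /graded_iso_mem[f [bf fM fG]]; apply/graded_iso_mem; exists f^-1%VF.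
have [fK fVK] := bijective_lfunVK bf; split; first by exists f.
  by move=> x y; apply: (bij_inj bf); rewrite fM !fVK.
by move=> g x; rewrite -fG fVK.
Qed.

Lemma graded_iso_trans A B D (Gam : G -> {vspace A}) (Del : G -> {vspace B})
    (Eps : G -> {vspace D}) :
  graded_iso Gam Del -> graded_iso Del Eps -> graded_iso Gam Eps.
Proof.
move=> /graded_iso_mem[f [bf fM fG]] /graded_iso_mem[h [bh hM hG]].
apply/graded_iso_mem; exists (h \o f)%VF; split.
- by apply: (eq_bij (bij_comp bh bf)) => x; rewrite comp_lfunE.
- by move=> x y; rewrite !comp_lfunE fM hM.
- by move=> g x; rewrite comp_lfunE hG fG.
Qed.

(** Inclusions are enough: they make f commute with the projections, and a homogeneous element is
    one fixed by its projection. *)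
Lemma graded_iso_of_sub A B (Gam : G -> {vspace A}) (Del : G -> {vspace B})
    (f : 'Hom(A, B)) : is_grading Gam -> is_grading Del ->
  bijective f -> (forall x y, f (x ** y) = f x ** f y) ->
  (forall g x, x \in Gam g -> f x \in Del g) -> graded_iso Gam Del.
Proof.
move=> grG grD bf fM fG; apply/graded_iso_mem; exists f; split=> // g x.
have [s [pi pr]] := grading_projections grG.
have [s' [pi' pr']] := grading_projections grD.
apply/idP/idP=> [xg|]; last exact: fG.
rewrite (memv_proj_id pr); apply: (bij_inj bf).
by rewrite (proj_comm pr pr' fG); apply/(memv_proj_id pr').
Qed.

End GradedAlgebras.

(** * Simple algebras and their products *)

Section Simple.
Variable F : fieldType.
Implicit Types A B D : nalgebra F.

(** Subspaces are [Prop]-valued predicates here, because the ideals below are given by quantified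
    formulas: an annihilator, or the image of a factor. *)
Definition subspace_pred (V : vectType F) (P : V -> Prop) : Prop :=
  P 0 /\ forall a x y, P x -> P y -> P (a *: x + y).

Lemma subspace_predD (V : vectType F) (P : V -> Prop) : subspace_pred P ->
  forall x y, P x -> P y -> P (x + y).
Proof. by case=> _ Plin x y Px Py; rewrite -[x]scale1r; apply: Plin. Qed.

Lemma subspace_predZ (V : vectType F) (P : V -> Prop) : subspace_pred P ->
  forall a x, P x -> P (a *: x).
Proof. by case=> P0 Plin a x Px; rewrite -[_ *: _]addr0; apply: Plin. Qed.

Definition ideal_pred A (P : A -> Prop) : Prop :=
  subspace_pred P /\ forall x y : A, P y -> P (nalg_mul A x y) /\ P (nalg_mul A y x).

Definition simple_nalg A : Prop := (exists x y : A, x ** y != 0) /\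
  forall P : A -> Prop, ideal_pred P -> (forall x, P x -> x = 0) \/ (forall x, P x).

Lemma simple_center A : simple_nalg A ->
  forall x : A, (forall y, x ** y = 0 /\ y ** x = 0) -> x = 0.
Proof.
case=> -[u [v uv]] simpA; pose P (x : A) := forall y, x ** y = 0 /\ y ** x = 0.
have idP : ideal_pred P.
  split; first split; first by move=> y; rewrite linear0l linear0r.
    move=> a x y Px Py z; rewrite linearPl linearPr /=.
    by rewrite (Px z).1 (Px z).2 (Py z).1 (Py z).2 scaler0 addr0.
  move=> x y Py; rewrite (Py x).1 (Py x).2.
  by split=> z; rewrite linear0l linear0r.
case: (simpA P idP) => [//|Pall].
by case/eqP: uv; rewrite (Pall u v).1.
Qed.

Lemma simple_transport A B (f : {linear A -> B}) : bijective f ->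
  (forall x y, f (x ** y) = f x ** f y) -> simple_nalg A -> simple_nalg B.
Proof.
move=> bf fM [[u [v uv]] simpA]; case: (bf) => g fK gK; split.
  by exists (f u), (f v); rewrite -fM -(linear0 f) (inj_eq (bij_inj bf)).
move=> P [[P0 Plin] Pid].
case: (simpA (fun x => P (f x))) => [|Pz|Pall].
- split; first split; first by rewrite linear0.
    by move=> a x y Px Py; rewrite linearP; apply: Plin.
  by move=> x y Py; rewrite !fM; apply: Pid.
- by left=> x Px; rewrite -[x]gK (Pz (g x)) ?linear0 ?gK.
- by right=> x; rewrite -[x]gK.
Qed.

(** Multiplying (a, b) in P by (c, 0) puts (ac, 0) and (ca, 0) in P. So if P meets the first factor
    trivially, first coordinates of P annihilate A and vanish by [simple_center]; likewise for the
    second factor. *)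
Lemma simple_prod_ideal A B (P : prodA A B -> Prop) :
  simple_nalg A -> simple_nalg B -> ideal_pred P ->
  [\/ forall x, P x -> x = 0, forall x, P x <-> x.2 = 0,
      forall x, P x <-> x.1 = 0 | forall x, P x].
Proof.
move=> sA sB [subP Pid]; have [P0 Plin] := subP; have PD := subspace_predD subP.
have pairE (x : prodA A B) : x = (x.1, 0) + (0, x.2).
  by case: x => a b; congr pair; rewrite /= ?addr0 ?add0r.
have idA : ideal_pred (fun a : A => P (a, 0)).
  split; first split=> // [a x y Px Py].
    have -> : (a *: x + y, 0) = a *: (x, 0) + (y, 0) :> prodA A B.
      by congr pair; rewrite /= ?scaler0 ?addr0.
    exact: Plin.
  move=> x y /(Pid (x, 0)); rewrite /= /prod_mul /=.
  by rewrite !linear0l.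
have idB : ideal_pred (fun b : B => P (0, b)).
  split; first split=> // [a x y Px Py].
    have -> : (0, a *: x + y) = a *: (0, x) + (0, y) :> prodA A B.
      by congr pair; rewrite /= ?scaler0 ?addr0.
    exact: Plin.
  move=> x y /(Pid (0, x)); rewrite /= /prod_mul /=.
  by rewrite !linear0l.
have mulA_ x a : P x -> P (x.1 ** a, 0) /\ P (a ** x.1, 0).
  by move=> /(Pid (a, 0)); rewrite /= /prod_mul /= linear0r linear0l => -[].
have mulB_ x b : P x -> P (0, x.2 ** b) /\ P (0, b ** x.2).
  by move=> /(Pid (0, b)); rewrite /= /prod_mul /= linear0r linear0l => -[].
have A0 : (forall a, P (a, 0) -> a = 0) -> forall x, P x -> x.1 = 0.
  move=> z x Px; apply: (simple_center sA) => a.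
  by have [/z -> /z ->] := mulA_ x a Px.
have B0 : (forall b, P (0, b) -> b = 0) -> forall x, P x -> x.2 = 0.
  move=> z x Px; apply: (simple_center sB) => a.
  by have [/z -> /z ->] := mulB_ x a Px.
case: (sA.2 _ idA) => [/A0|] zA; case: (sB.2 _ idB) => [/B0|] zB.
- by constructor 1 => x Px; rewrite (pairE x) zA // zB // addr0.
- constructor 3 => x; split; first exact: zA.
  by move=> x1; rewrite (pairE x) x1; apply: PD.
- constructor 2 => x; split; first exact: zB.
  by move=> x2; rewrite (pairE x) x2; apply: PD.
- by constructor 4 => x; rewrite (pairE x); apply: PD.
Qed.

End Simple.

(** * Isomorphisms between products of simple algebras *)

Section Products.
Variable F : fieldType.
Implicit Types A B : nalgebra F.

Lemma exists_linfun (V W : vectType F) (f : V -> W) : linear f ->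
  exists h : 'Hom(V, W), h =1 f.
Proof.
move=> lin_f; pose f_lin := GRing.isLinear.Build F V W *:%R f lin_f.
exists (linfun (HB.pack_for {linear V -> W} f f_lin)) => x; exact: lfunE.
Qed.

Lemma lfun_bij (V W : vectType F) (f : 'Hom(V, W)) :
  injective f -> (forall y, exists x, f x = y) -> bijective f.
Proof.
move=> /lker0P ker0 surj; exists f^-1%VF; first exact: lker0_lfunK.
by move=> y; have [x <-] := surj y; rewrite (lker0_lfunK ker0).
Qed.

Lemma simple_neq0 A : simple_nalg A -> exists x : A, x != 0.
Proof.
case=> -[x [y xy]] _; exists x.
by apply: contraNneq xy => ->; rewrite linear0l.
Qed.

Lemma prod_fst_ideal A B A' B' (f : 'Hom(prodA A B, prodA A' B')) :
  bijective f -> (forall x y, f (x ** y) = f x ** f y) ->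
  ideal_pred (A := prodA A' B') (fun y => exists a, y = f (a, 0)).
Proof.
move=> bf fM; have [_ fVK] := bijective_lfunVK bf.
split; first split; first by exists 0; rewrite linear0.
  move=> c _ _ [a ->] [b ->]; exists (c *: a + b); rewrite -linearP; congr (f _).
  by congr pair; rewrite /= ?scaler0 ?addr0.
move=> x _ [a ->]; rewrite -[x]fVK -!fM; case: (f^-1%VF x) => c d.
by split; [exists (c ** a) | exists (a ** c)];
  rewrite /= /prod_mul /= ?linear0r ?linear0l.
Qed.

Definition swap_prod A B (x : prodA A B) : prodA B A := (x.2, x.1).

Lemma exists_swap_prod A B : exists f : 'Hom(prodA A B, prodA B A),
  [/\ bijective f, forall x y, f (x ** y) = f x ** f y & forall a b, f (a, b) = (b, a)].
Proof.
have [|f fE] := @exists_linfun (prodA A B) (prodA B A) (@swap_prod A B).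
  by move=> c x y; congr pair.
exists f; split=> [|x y|a b]; rewrite ?fE //.
apply: (@eq_bij _ _ (@swap_prod A B)) => [|x]; last by rewrite fE.
by exists (@swap_prod B A) => -[].
Qed.

Lemma prod_iso_fst A B A' B' (f : 'Hom(prodA A B, prodA A' B')) :
  bijective f -> (forall x y, f (x ** y) = f x ** f y) ->
  (forall y, (exists a, y = f (a, 0)) <-> y.2 = 0) ->
  exists u : 'Hom(A, A'), [/\ bijective u, forall x y, u (x ** y) = u x ** u y
    & forall a, f (a, 0) = (u a, 0)].
Proof.
move=> bf fM Hf; have [|u uE] := @exists_linfun A A' (fun a => (f (a, 0)).1).
  move=> c x y; have -> : (c *: x + y, 0) = c *: (x, 0) + (y, 0) :> prodA A B.
    by congr pair; rewrite /= ?scaler0 ?addr0.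
  by rewrite linearP.
have fE a : f (a, 0) = (u a, 0).
  by rewrite uE; apply/eqP; rewrite -pair_eqE /= eqxx; apply/eqP/Hf; exists a.
exists u; split=> //; last first.
  move=> x y; have := fM (x, 0) (y, 0); rewrite /= /prod_mul /= linear0l !fE.
  by case.
apply: lfun_bij => [x y xy | y].
  by have := bij_inj bf (x1 := (x, 0)) (x2 := (y, 0)); rewrite !fE xy => /(_ erefl) [].
by have [a] := (Hf (y, 0)).2 erefl; rewrite fE => -[->]; exists a.
Qed.

(** The images of the two factors are ideals, neither 0 nor everything, hence factors of the target;
    by injectivity they are different ones. *)
Lemma simple_prod_iso A B A' B' (f : 'Hom(prodA A B, prodA A' B')) :
  simple_nalg A -> simple_nalg B -> simple_nalg A' -> simple_nalg B' ->
  bijective f -> (forall x y, f (x ** y) = f x ** f y) ->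
  (exists (u : 'Hom(A, A')) (v : 'Hom(B, B')),
     [/\ bijective u, forall x y, u (x ** y) = u x ** u y,
         bijective v, forall x y, v (x ** y) = v x ** v y
       & forall a b, f (a, b) = (u a, v b)]) \/
  (exists (u : 'Hom(A, B')) (v : 'Hom(B, A')),
     [/\ bijective u, forall x y, u (x ** y) = u x ** u y,
         bijective v, forall x y, v (x ** y) = v x ** v y
       & forall a b, f (a, b) = (v b, u a)]).
Proof.
move=> sA sB sA' sB' bf fM.
have [swB [bswB swBM swBE]] := exists_swap_prod B A.
have [swB' [bswB' swBM' swBE']] := exists_swap_prod A' B'.
have [a0 na0] := simple_neq0 sA; have [b0 nb0] := simple_neq0 sB.
have finj := bij_inj bf.
have fD a b : f (a, b) = f (a, 0) + f (0, b).
  by rewrite -linearD; congr (f _); congr pair; rewrite /= ?addr0 ?add0r.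
have [f0 fT] : ~ (forall y : prodA A' B', (exists a, y = f (a, 0)) -> y = 0) /\
    ~ (forall y : prodA A' B', exists a, y = f (a, 0)).
  split=> H; first case/eqP: na0.
    by have := H _ (ex_intro _ a0 erefl); rewrite -(linear0 f) => /finj [].
  by case: (H (f (0, b0))) => a /finj [_ /eqP]; rewrite (negPf nb0).
(* Precomposing with the swap presents the image of the second factor as that of a first factor, so
   the lemmas on first factors apply to both. *)
pose g := (f \o swB)%VF.
have gE b a : g (b, a) = f (a, b) by rewrite comp_lfunE swBE.
have bg : bijective g.
  by apply: (eq_bij (bij_comp bf bswB)) => x; rewrite comp_lfunE.
have gM x y : g (x ** y) = g x ** g y by rewrite !comp_lfunE swBM fM.
have [g0 gT] : ~ (forall y : prodA A' B', (exists b, y = g (b, 0)) -> y = 0) /\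
    ~ (forall y : prodA A' B', exists b, y = g (b, 0)).
  split=> H; first case/eqP: nb0.
    by have := H _ (ex_intro _ b0 erefl); rewrite gE -(linear0 f) => /finj [].
  by case: (H (f (a0, 0))) => b; rewrite gE => /finj [/eqP]; rewrite (negPf na0).
have fg a b : f (a, 0) = g (b, 0) -> a = 0 /\ b = 0 by rewrite gE => /finj [-> <-].
case: (simple_prod_ideal sA' sB' (prod_fst_ideal bf fM)) => // Pf;
  case: (simple_prod_ideal sA' sB' (prod_fst_ideal bg gM)) => // Pg.
- have [|b fgE] := (Pg (f (a0, 0))).2 _; first by apply/Pf; exists a0.
  by case/eqP: na0; case: (fg _ _ fgE).
- left; have [u [bu uM uE]] := prod_iso_fst bf fM Pf.
  pose h := (swB' \o g)%VF.
  have hE x : h x = swB' (g x) by rewrite comp_lfunE.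
  have bh : bijective h.
    by apply: (eq_bij (bij_comp bswB' bg)) => x; rewrite hE.
  have hM x y : h (x ** y) = h x ** h y by rewrite !hE gM swBM'.
  have [|v [bv vM vE]] := prod_iso_fst bh hM.
    move=> [y2 y1]; split=> [[b]|/= y10].
      rewrite hE; have: exists b', g (b, 0) = g (b', 0) by exists b.
      by move/Pg; case: (g _) => z1 z2 /= ->; rewrite swBE' => -[_ ->].
    have [|b bE] := (Pg (y1, y2)).2 _; first by [].
    by exists b; rewrite hE -bE swBE'.
  exists u, v; split=> // a b; rewrite fD uE -gE.
  have := vE b; rewrite hE; case: (g (b, 0)) => z1 z2; rewrite swBE' => -[-> ->].
  by congr pair; rewrite /= ?addr0 ?add0r.
- right; have [v [bv vM vE]] := prod_iso_fst bg gM Pg.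
  pose h := (swB' \o f)%VF.
  have hE x : h x = swB' (f x) by rewrite comp_lfunE.
  have bh : bijective h.
    by apply: (eq_bij (bij_comp bswB' bf)) => x; rewrite hE.
  have hM x y : h (x ** y) = h x ** h y by rewrite !hE fM swBM'.
  have [|u [bu uM uE]] := prod_iso_fst bh hM.
    move=> [y2 y1]; split=> [[b]|/= y10].
      rewrite hE; have: exists b', f (b, 0) = f (b', 0) by exists b.
      by move/Pf; case: (f _) => z1 z2 /= ->; rewrite swBE' => -[_ ->].
    have [|b bE] := (Pf (y1, y2)).2 _; first by [].
    by exists b; rewrite hE -bE swBE'.
  exists u, v; split=> // a b; rewrite fD -(gE b 0) vE.
  have := uE a; rewrite hE; case: (f (a, 0)) => z1 z2; rewrite swBE' => -[-> ->].
  by congr pair; rewrite /= ?addr0 ?add0r.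
- have [|b fgE] := (Pg (f (a0, 0))).2 _; first by apply/Pf; exists a0.
  by case/eqP: na0; case: (fg _ _ fgE).
Qed.

Variable G : zmodType.

Lemma prod_graded_iso A B A' B' (Gam1 : G -> {vspace A}) (Gam2 : G -> {vspace B})
    (Del1 : G -> {vspace A'}) (Del2 : G -> {vspace B'}) :
  graded_iso Gam1 Del1 -> graded_iso Gam2 Del2 ->
  graded_iso (prod_grading Gam1 Gam2) (prod_grading Del1 Del2).
Proof.
move=> /graded_iso_mem[u [bu uM uG]] /graded_iso_mem[v [bv vM vG]].
apply/graded_iso_mem.
have [|f fE] := @exists_linfun (prodA A B) (prodA A' B') (fun x => (u x.1, v x.2)).
  by move=> c x y; congr pair; rewrite /= linearP.
have [uK uVK] := bijective_lfunVK bu; have [vK vVK] := bijective_lfunVK bv.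
exists f; split=> [|x y|g [a b]].
- apply: lfun_bij => [[a b] [c d]|[a b]].
    by rewrite !fE /= => -[/(bij_inj bu) -> /(bij_inj bv) ->].
  by exists (u^-1%VF a, v^-1%VF b); rewrite fE /= uVK vVK.
- by rewrite !fE /= /prod_mul /= uM vM.
- by rewrite fE !memv_prodv uG vG.
Qed.

Lemma prod_graded_swap A B (Gam1 : G -> {vspace A}) (Gam2 : G -> {vspace B}) :
  graded_iso (prod_grading Gam1 Gam2) (prod_grading Gam2 Gam1).
Proof.
apply/graded_iso_mem; have [f [bf fM fE]] := exists_swap_prod A B.
by exists f; split=> // g [a b]; rewrite fE !memv_prodv andbC.
Qed.

Lemma simple_prod_graded_iso A B A' B' (Gam1 : G -> {vspace A}) (Gam2 : G -> {vspace B})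
    (Del1 : G -> {vspace A'}) (Del2 : G -> {vspace B'}) :
  simple_nalg A -> simple_nalg B -> simple_nalg A' -> simple_nalg B' ->
  graded_iso (prod_grading Gam1 Gam2) (prod_grading Del1 Del2) <->
  (graded_iso Gam1 Del1 /\ graded_iso Gam2 Del2) \/
  (graded_iso Gam1 Del2 /\ graded_iso Gam2 Del1).
Proof.
move=> sA sB sA' sB'; split; last first.
  case=> -[iso1 iso2]; first exact: prod_graded_iso.
  exact: graded_iso_trans (prod_graded_iso iso1 iso2) (prod_graded_swap _ _).
move=> /graded_iso_mem[f [bf fM fG]].
case: (simple_prod_iso sA sB sA' sB' bf fM) => -[u [v [bu uM bv vM fE]]].
  left; split; apply/graded_iso_mem; [exists u | exists v]; split=> // g x.
    by have := fG g (x, 0); rewrite fE !memv_prodv linear0 !mem0v !andbT.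
  by have := fG g (0, x); rewrite fE !memv_prodv linear0 !mem0v.
right; split; apply/graded_iso_mem; [exists u | exists v]; split=> // g x.
  by have := fG g (x, 0); rewrite fE !memv_prodv linear0 !mem0v !andbT.
by have := fG g (0, x); rewrite fE !memv_prodv linear0 !mem0v !andbT.
Qed.

End Products.

(** * Internal direct products *)

Section InternalProduct.
Variables (F : fieldType) (A : nalgebra F) (U V : {vspace A}).
Variables (clU : mul_closed U) (clV : mul_closed V) (clUV : mul_closed (U + V)%VS).
Hypothesis mulUV : forall x y, x \in U -> y \in V -> x ** y = 0 /\ y ** x = 0.
Hypothesis capUV : (U :&: V = 0)%VS.

Lemma internal_prod : exists f : 'Hom(prodA (subA clU) (subA clV), subA clUV),
  [/\ bijective f, forall x y, f (x ** y) = f x ** f y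
    & forall x, vsval (f x) = vsval x.1 + vsval x.2].
Proof.
have mem_sum (x : prodA (subA clU) (subA clV)) :
    vsval (U := U) x.1 + vsval (U := V) x.2 \in (U + V)%VS.
  by apply: memv_add; apply: subvsP.
have [|f fE] := @exists_linfun _ (prodA (subA clU) (subA clV)) (subA clUV)
    (fun x => Subvs (mem_sum x)).
  by move=> c x y; apply: subvs_inj; rewrite /= scalerDr addrACA.
exists f; split=> [|x y|x]; last by rewrite fE.
- apply: lfun_bij => [[a b] [c d]|y].
    rewrite !fE => /(congr1 vsval) /= abE.
    have ac : vsval a - vsval c = vsval d - vsval b.
      by rewrite -[vsval a](addrK (vsval b)) abE addrAC [_ + vsval d]addrC addrK.
    have : vsval a - vsval c \in (U :&: V)%VS.
      by rewrite memv_cap {2}ac !memvB ?subvsP.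
    rewrite capUV memv0 => /eqP E0; move: ac; rewrite E0 => /esym/eqP.
    move/eqP: E0; rewrite !subr_eq0 => /eqP/subvs_inj -> /eqP/subvs_inj ->.
    by [].
  have /memv_addP[a aU [b bV abE]] := subvsP y.
  by exists (Subvs aU, Subvs bV); rewrite fE; apply: subvs_inj.
- rewrite !fE; apply: subvs_inj; rewrite /= linearDl !linearDr /=.
  have [-> _] := mulUV (subvsP x.1) (subvsP y.2).
  have [_ ->] := mulUV (subvsP y.1) (subvsP x.2).
  by rewrite addr0 add0r.
Qed.

(** If x + y has degree g, then pi g x - x = y - pi g y lies in both U and V, hence is 0; so x and y
    have degree g. *)
Lemma internal_prod_graded_iso (G : zmodType) (Gam : G -> {vspace A}) s pi :
  projections Gam s pi ->
  (forall g x, x \in U -> pi g x \in U) -> (forall g x, x \in V -> pi g x \in V) ->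
  graded_iso (fun g => restrv clUV (Gam g))
    (prod_grading (fun g => restrv clU (Gam g)) (fun g => restrv clV (Gam g))).
Proof.
move=> pr stU stV; apply/graded_iso_sym/graded_iso_mem.
have [f [bf fM fE]] := internal_prod; exists f; split=> // g [x y].
rewrite memv_restrv fE memv_prodv !memv_restrv /=.
apply/idP/andP=> [/(proj_id pr)|[xg yg]]; last by rewrite memvD.
rewrite linearD /= => E.
have E' : pi g (vsval x) - vsval x = vsval y - pi g (vsval y).
  by rewrite -[pi g (vsval x)](addrK (pi g (vsval y))) E addrAC [vsval x + _]addrC addrK.
have : pi g (vsval x) - vsval x \in (U :&: V)%VS.
  by rewrite memv_cap {2}E' !memvB ?stU ?stV ?subvsP.
rewrite capUV memv0 => /eqP E0; move: E'; rewrite E0 => /esym/eqP.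
move/eqP: E0; rewrite !subr_eq0 => /eqP xE /eqP yE.
by rewrite -xE yE !(proj_mem pr).
Qed.

End InternalProduct.

(** * The alternative nucleus of a tensor product *)

Section Tensors.
Variable F : fieldType.
Implicit Types U V W Z : vectType F.

Lemma tens_ind U V (P : tensv U V -> Prop) : subspace_pred P ->
  (forall u v, P (tens u v)) -> forall t, P t.
Proof.
move=> subP Ptens t; rewrite [t]tensv_basis; have P0 := subP.1.
have PD := subspace_predD subP; apply: big_ind => // i _; apply: big_ind => // j _.
exact: subspace_predZ.
Qed.

Lemma exists_tens_lift U V W (b : U -> V -> W) : bilinear_for *:%R *:%R b ->
  exists h : 'Hom(tensv U V, W), forall u v, h (tens u v) = b u v.
Proof.
move=> bil_b; pose bB := bilinear_isBilinear.Build F U V W *:%R *:%R b bil_b.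
have [h hE _] := tensvP (HB.pack_for {bilinear U -> V -> W} b bB).
by exists (linfun h) => u v; rewrite lfunE /= hE.
Qed.

Lemma coord_eq0 V (v : V) : (forall i, coord (vbasis {:V}) i v = 0) -> v = 0.
Proof. by move=> v0; rewrite [v]stdb_sum big1 // => i _; rewrite v0 scale0r. Qed.

(* The sums are (f j (x) g k) t and (p (x) q) t in coordinates. *)
Lemma tens_family_ker U V W Z U' V' (J K : Type) (f : J -> U -> W) (g : K -> V -> Z)
    (p : U -> U') (q : V -> V') :
  (forall j, linear (f j)) -> (forall k, linear (g k)) -> linear p -> linear q ->
  (forall u, (forall j, f j u = 0) -> p u = 0) ->
  (forall v, (forall k, g k v = 0) -> q v = 0) ->
  forall t : tensv U V,
  (forall j k, \sum_i \sum_l t i l *: tens (f j (stdb i)) (g k (stdb l)) = 0) ->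
  \sum_i \sum_l t i l *: tens (p (stdb i)) (q (stdb l)) = 0.
Proof.
move=> lf lg lp lq kerf kerg t t0.
have lin_sum (X Y : vectType F) (h : X -> Y) : linear h ->
    forall (I : finType) (c : I -> F) (x : I -> X),
    h (\sum_i c i *: x i) = \sum_i c i *: h (x i).
  move=> /exists_linfun[h' h'E] I c x; rewrite -h'E linear_sum.
  by apply: eq_bigr => i _; rewrite linearZ /= h'E.
have entry (X Y X' Y' : vectType F) (a : X -> X') (b : Y -> Y') (s : tensv X Y) m r :
    (\sum_i \sum_l s i l *: tens (a (stdb i)) (b (stdb l))) m r =
    \sum_i \sum_l s i l * (coord (vbasis fullv) m (a (stdb i))
      * coord (vbasis fullv) r (b (stdb l))).
  rewrite summxE; apply: eq_bigr => i _; rewrite summxE; apply: eq_bigr => l _.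
  by rewrite !mxE.
apply/matrixP => m r; rewrite entry mxE.
(* Here u is the slice of t by the r-th coordinate of q, and v below is the slice by the m'-th
   coordinate of f j. Coordinate m' of f j u equals coordinate r of q v, and g k v = 0 for all k by
   hypothesis. *)
pose u := \sum_i (\sum_l t i l * coord (vbasis fullv) r (q (stdb l))) *: stdb i.
have pu : p u = 0.
  apply: kerf => j; apply: coord_eq0 => m'.
  pose v := \sum_l (\sum_i t i l * coord (vbasis fullv) m' (f j (stdb i))) *: stdb l.
  have qv : q v = 0.
    apply: kerg => k; apply: coord_eq0 => r'; rewrite /v lin_sum // linear_sum.
    have /matrixP/(_ m' r') := t0 j k; rewrite entry mxE exchange_big => E.
    apply: etrans E => /=.
    apply: eq_bigr => l _; rewrite linearZ /= mulr_suml.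
    by apply: eq_bigr => i _; rewrite mulrA.
  have /(congr1 (coord (vbasis fullv) r)) := qv.
  rewrite /u /v !lin_sum // !linear_sum linear0 => E; apply: etrans E.
  under eq_bigr => i _ do rewrite linearZ /= mulr_suml.
  under [RHS]eq_bigr => l _ do rewrite linearZ /= mulr_suml.
  rewrite exchange_big; apply: eq_bigr => l _; apply: eq_bigr => i _.
  by rewrite mulrAC.
have /(congr1 (coord (vbasis fullv) m)) := pu.
rewrite /u lin_sum // linear_sum linear0 => E; apply: etrans E.
apply: eq_bigr => i _; rewrite linearZ /= mulr_suml.
by apply: eq_bigr => l _; rewrite -mulrA [_ * coord _ m _]mulrC.
Qed.

End Tensors.

(** * The left alternative law as a linear condition on t *)

Section AlternativeNucleus.
Variables (F : fieldType) (A : nalgebra F).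
Implicit Types t x y : A.

(** This is (t, x, y) + (x, t, y), where (a, b, c) = (ab)c - a(bc). *)
Definition alt_defect t x y : A :=
  ((t ** x) ** y - t ** (x ** y)) + ((x ** t) ** y - x ** (t ** y)).

Definition alt_nucleus t : Prop := forall x y, alt_defect t x y = 0.

Fact alt_defect_rearrange (V : lmodType F) c (a b d e a' b' d' e' : V) :
  (c *: a + a' - (c *: b + b')) + ((c *: d + d') - (c *: e + e')) =
  c *: ((a - b) + (d - e)) + ((a' - b') + (d' - e')).
Proof.
rewrite scalerDr !scalerBr !opprD [c *: a + _ + _]addrACA [c *: d + _ + _]addrACA.
exact: addrACA.
Qed.

Lemma alt_defect_linear1 x y : linear (fun t => alt_defect t x y).
Proof.
move=> c t t'; rewrite /alt_defect -alt_defect_rearrange.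
by rewrite !(linearPl, linearPr).
Qed.

Lemma alt_defect_linear2 t y : linear (fun x => alt_defect t x y).
Proof.
move=> c x x'; rewrite /alt_defect -alt_defect_rearrange.
by rewrite !(linearPl, linearPr).
Qed.

Lemma alt_defect_linear3 t x : linear (fun y => alt_defect t x y).
Proof.
move=> c y y'; rewrite /alt_defect -alt_defect_rearrange.
by rewrite !(linearPl, linearPr).
Qed.

Lemma linear_ker_subspace (V W : vectType F) (f : V -> W) :
  linear f -> subspace_pred (fun v => f v = 0).
Proof.
move=> /exists_linfun[h hE]; split; first by rewrite -hE linear0.
by move=> a x y fx fy; rewrite -hE linearP /= !hE fx fy scaler0 addr0.
Qed.

Lemma alt_nucleus_subspace : subspace_pred alt_nucleus.
Proof.
split=> [x y|a t t' Nt Nt' x y].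
  exact: (linear_ker_subspace (alt_defect_linear1 x y)).1.
exact: (linear_ker_subspace (alt_defect_linear1 x y)).2.
Qed.

(** For x of degree h and y of degree k, the defect of pi g t is the component of degree g + h + k
    of the defect of t; linearity in x and y reduces to this case. *)
Lemma alt_nucleus_proj (G : zmodType) (Gam : G -> {vspace A}) s pi :
  is_grading Gam -> projections Gam s pi ->
  forall g t, alt_nucleus t -> alt_nucleus (pi g t).
Proof.
move=> grG pr g t Nt x.
have lin2 y := linear_ker_subspace (alt_defect_linear2 (pi g t) y).
have lin3 z := linear_ker_subspace (alt_defect_linear3 (pi g t) z).
move: x; apply: (graded_ind pr) => [y|x z Hx Hz y|h x xh].
- exact: (lin2 y).1.
- by apply: (subspace_predD (lin2 y)); [apply: Hx | apply: Hz].
apply: (graded_ind pr) => [|y z|k y yk]; first exact: (lin3 x).1.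
  exact: subspace_predD (lin3 x) y z.
transitivity (pi (g + h + k) (alt_defect t x y)); last by rewrite Nt linear0.
have E1 : pi (g + h + k) (t ** x ** y) = pi g t ** x ** y.
  by rewrite (proj_mulr grG pr _ _ yk) (proj_mulr grG pr _ _ xh).
have E2 : pi (g + h + k) (t ** (x ** y)) = pi g t ** (x ** y).
  by rewrite -addrA (proj_mulr grG pr _ _ (grading_mul grG xh yk)).
have E3 : pi (g + h + k) (x ** t ** y) = x ** pi g t ** y.
  by rewrite (addrC g) (proj_mulr grG pr _ _ yk) (proj_mull grG pr _ _ xh).
have E4 : pi (g + h + k) (x ** (t ** y)) = x ** (pi g t ** y).
  by rewrite (addrC g) -addrA (proj_mull grG pr _ _ xh) (proj_mulr grG pr _ _ yk).
by rewrite /alt_defect linearD !linearB /= E1 E2 E3 E4.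
Qed.

End AlternativeNucleus.

Lemma alt_nucleus_hom (F : fieldType) (A B : nalgebra F) (f : 'Hom(A, B)) :
  bijective f -> (forall x y, f (x ** y) = f x ** f y) ->
  forall t, alt_nucleus t -> alt_nucleus (f t).
Proof.
move=> bf fM t Nt x y; have [_ fVK] := bijective_lfunVK bf.
rewrite -[x]fVK -[y]fVK /alt_defect -!fM -!linearB -linearD /=.
by rewrite -/(alt_defect _ _ _) Nt linear0.
Qed.

(** * The skew elements of the tensor square *)

Section CayleySquare.
Variables (F : fieldType) (C : cayleyAlgebra F).
Hypothesis two_neq0 : 2%:R != 0 :> F.
Local Notation one := (comp_one C).
Local Notation pol := (@comp_polar F C).

Lemma cayley_dim_gt k : (k < 8)%N -> (k < \dim {:C})%N.
Proof. by rewrite cayley_dim. Qed.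

Lemma cayley_norm_one : comp_norm one = 1.
Proof.
have [w w0 _] := @exists_orthogonal F C [::] (cayley_dim_gt (isT : (0 < 8)%N)).
exact: norm_one w0.
Qed.

Lemma polar_one_one : pol one one = 2%:R.
Proof. by rewrite polar_diag cayley_norm_one mulr1. Qed.

(** Projection of C onto C_0 along F1. *)
Let pr (x : C) : C := x - (2%:R^-1 * pol x one) *: one.

Fact pr_linear : linear pr.
Proof.
move=> a x y; rewrite /pr linearPl /= mulrDr scalerDl opprD addrACA scalerBr.
by rewrite mulrCA scalerA.
Qed.

Fact pr_skew x : pol (pr x) one = 0 :> F.
Proof. by rewrite /pr linearBl linearZl_LR /= polar_one_one; field. Qed.

Fact prE x : x = (2%:R^-1 * pol x one) *: one + pr x :> C.
Proof. by rewrite /pr addrC subrK. Qed.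

(* Qualified: mathcomp's sesquilinear.v also has a notation [skew]. *)
Lemma memv_skewP (x : C) : x \in Defs.skew C <-> pol x one = 0.
Proof. by rewrite memv_skewE; split=> [/eqP|->]. Qed.

Lemma skewvP (t : CC C) : t \in skewv C <->
  exists x y, [/\ pol x one = 0, pol y one = 0 & t = tensl x + tensr y].
Proof.
split=> [/memv_addP[_ /leftvP[x /memv_skewP Sx ->]]|].
  by case=> _ /rightvP[y /memv_skewP Sy ->] ->; exists x, y.
case=> x [y [/memv_skewP Sx /memv_skewP Sy ->]].
by apply: memv_add; [apply/leftvP; exists x | apply/rightvP; exists y].
Qed.

(** Partial traces: they send x (x) 1 + 1 (x) y, with x and y skew, to 2x and 2y, which separates
    the two summands of S. *)
Lemma exists_trace_maps : exists trl trr : 'Hom(CC C, C),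
  (forall x y, trl (tens x y) = pol y one *: x) /\
  (forall x y, trr (tens x y) = pol x one *: y).
Proof.
have [|trl trlE] := @exists_tens_lift F C C C (fun x y => pol y one *: x).
  split=> [y|x] a u v /=; first by rewrite scalerDr !scalerA mulrC.
  by rewrite linearPl /= scalerDl scalerA.
have [|trr trrE] := @exists_tens_lift F C C C (fun x y => pol x one *: y).
  split=> [y|x] a u v /=; first by rewrite linearPl /= scalerDl scalerA.
  by rewrite scalerDr !scalerA mulrC.
by exists trl, trr.
Qed.

Lemma skew_tens_inj x y x' y' : pol x one = 0 -> pol y one = 0 ->
  pol x' one = 0 -> pol y' one = 0 ->
  tensl x + tensr y = tensl x' + tensr y' -> x = x' /\ y = y'.
Proof.
move=> Sx Sy Sx' Sy' E; have [trl [trr [trlE trrE]]] := exists_trace_maps.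
have := congr1 trl E; rewrite !linearD /= !trlE Sy Sy' !scale0r !addr0 polar_one_one.
move=> /(scalerI two_neq0) ->.
have := congr1 trr E; rewrite !linearD /= !trrE Sx Sx' !scale0r !add0r polar_one_one.
by move=> /(scalerI two_neq0) ->.
Qed.

Lemma cap_leftv_rightv : (leftv C :&: rightv C = 0)%VS.
Proof.
apply/eqP; rewrite -subv0; apply/subvP => t.
move=> /memv_capP[/leftvP[x Sx tx] /rightvP[y Sy ty]].
have E : tensl x + tensr 0 = tensl 0 + tensr y :> CC C.
  by rewrite !linear0 addr0 add0r /tensl -tx ty.
have S0 : pol 0 one = 0 by rewrite linear0l.
move: Sx Sy => /memv_skewP Sx /memv_skewP Sy.
have [x0 _] := skew_tens_inj Sx S0 S0 Sy E.
by rewrite tx x0 linear0l memv0.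
Qed.

Lemma alt_nucleus_tens x y : alt_nucleus (tensl x + tensr y : CC C).
Proof.
have [N0 Nlin] := @alt_nucleus_subspace F (CC C).
suff [Nl Nr] : alt_nucleus (tensl x : CC C) /\ alt_nucleus (tensr y : CC C).
  by rewrite -[tensl x]scale1r; apply: Nlin.
have ext (t : CC C) : (forall a b c d, alt_defect t (tens a b) (tens c d) = 0) ->
    alt_nucleus t.
  move=> H X Y; move: X.
  apply: (tens_ind (linear_ker_subspace (alt_defect_linear2 t Y))) => a b; move: Y.
  by apply: (tens_ind (linear_ker_subspace (alt_defect_linear3 t (tens a b)))).
split; apply: ext => a b c d; rewrite /alt_defect /tensl /tensr.
  rewrite !tens_mulE !comp_mul1l !comp_mulr1 /=.
  by rewrite -!linearBl -linearDl /= left_alternative2 linear0l.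
rewrite !tens_mulE !comp_mul1l !comp_mulr1 /=.
by rewrite -!linearBr -linearDr /= left_alternative2 linear0r.
Qed.

(** Modulo C (x) 1 + 1 (x) C, t equals its image under [pr] (x) [pr]. That image vanishes by
    [tens_family_ker], with associators on the left factor, whose common kernel [pr] kills by
    [nucleus_skew], and commutators on the right one, by [center_skew]. *)
Lemma alt_nucleusP (t : CC C) :
  alt_nucleus t <-> exists x y, t = tensl x + tensr y.
Proof.
split=> [Nt|[x [y ->]]]; last exact: alt_nucleus_tens.
have dim4 := cayley_dim_gt (isT : (4 < 8)%N).
have dim2 := cayley_dim_gt (isT : (2 < 8)%N).
have decomp : exists x y, t = (\sum_i \sum_l t i l *: tens (pr (stdb i)) (pr (stdb l)))
    + (tensl x + tensr y).
  have [|h hE] := @exists_tens_lift F C C (CC C) (fun x y => tens (pr x) (pr y)).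
    split=> [y|x] a u v /=; first by rewrite pr_linear linearPl.
    by rewrite pr_linear linearPr.
  have -> : \sum_i \sum_l t i l *: tens (pr (stdb i)) (pr (stdb l)) = h t.
    rewrite [in RHS](tensv_basis t) linear_sum; apply: eq_bigr => i _.
    by rewrite linear_sum; apply: eq_bigr => l _; rewrite linearZ /= hE.
  move: {Nt} t; apply: tens_ind => [|u v].
    split; first by exists 0, 0; rewrite !linear0 !addr0.
    move=> a t1 t2 [x1 [y1 E1]] [x2 [y2 E2]]; exists (a *: x1 + x2), (a *: y1 + y2).
    rewrite {1}E1 {1}E2 !linearP /= !scalerDr addrACA; congr (_ + _).
    exact: addrACA.
  exists (2%:R^-1 * pol v one *: pr u), (2%:R^-1 * pol u one *: v).
  rewrite hE {1}(prE u) linearDl linearZl_LR /= {2}(prE v) linearDr linearZr_LR /=.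
  by rewrite /tensl /tensr linearZl_LR linearZr_LR /= addrC -addrA addrCA.
suff t0 : \sum_i \sum_l t i l *: tens (pr (stdb i)) (pr (stdb l)) = 0 :> CC C.
  by move: decomp; rewrite t0 => -[x [y ->]]; exists x, y; rewrite add0r.
pose asc (z : C * C) x := (x ** z.1) ** z.2 - x ** (z.1 ** z.2).
have asc_lin z : linear (asc z).
  move=> a x y; rewrite /asc !linearPl /= opprD addrACA.
  by rewrite scalerBr.
have asc_one z : asc z one = 0 by rewrite /asc !comp_mul1l subrr.
apply: (tens_family_ker (f := asc) (g := fun u x => comm_mul x u)) => //.
- by move=> u a x y; rewrite linearPl.
- exact: pr_linear.
- exact: pr_linear.
- move=> x ascx; apply: (nucleus_skew two_neq0 dim4 (pr_skew x)) => y z.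
  apply/eqP; rewrite -subr_eq0 -[X in X == 0]/(asc (y, z) (pr x)).
  have [h hE] := exists_linfun (asc_lin (y, z)).
  by rewrite -hE /pr linearB linearZ /= !hE ascx asc_one scaler0 subr0.
- move=> x commx; apply: (center_skew two_neq0 dim2 (pr_skew x)) => y.
  by rewrite /pr linearBl linearZl_LR /= commx comm_one_mul scaler0 subr0.
move=> [x y] u.
(* The defect of a (x) b at x (x) u, y (x) 1 is (a, x, y) (x) bu + (x, a, y) (x) ub, that is (a, x,
   y) (x) [b, u]. *)
have [h hE] := exists_linfun (alt_defect_linear1 (tens x u : CC C) (tens y one)).
have := Nt (tens x u) (tens y one); rewrite -hE {1}(tensv_basis t) linear_sum => E.
apply: etrans E; apply: eq_bigr => i _; rewrite linear_sum; apply: eq_bigr => l _.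
rewrite linearZ /= hE; congr (_ *: _).
rewrite /alt_defect !tens_mulE !comp_mulr1 -!linearBl /=.
have /eqP := left_alternative2 (stdb i) x y; rewrite addr_eq0 => /eqP ascE.
rewrite -[x ** _ ** _ - _]opprK -ascE linearNl /= -linearBr /=.
by [].
Qed.

(** By [skew_sum_comm] each element of S is a sum of four such commutators, scalars being absorbed
    in a factor; closure of P under sums is thus enough. *)
Lemma skewv_comm_ind (P : CC C -> Prop) :
  (forall s t, P s -> P t -> P (s + t)) ->
  (forall m m', alt_nucleus m -> alt_nucleus m' -> P (comm_mul m m')) ->
  forall t, t \in skewv C -> P t.
Proof.
move=> PD Pcomm t /skewvP[x [y [Sx Sy ->]]].
have dim2 := cayley_dim_gt (isT : (2 < 8)%N).
have [a [b ab]] := skew_sum_comm two_neq0 dim2.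
have [x1 [x2 ->]] := ab x Sx; have [y1 [y2 ->]] := ab y Sy.
have Nl z : alt_nucleus (tensl z : CC C).
  by apply/alt_nucleusP; exists z, 0; rewrite linear0 addr0.
have Nr z : alt_nucleus (tensr z : CC C).
  by apply/alt_nucleusP; exists 0, z; rewrite linear0 add0r.
have tlD u v : tensl (u + v) = tensl u + tensl v :> CC C := linearD _ _ _.
have trD u v : tensr (u + v) = tensr u + tensr v :> CC C := linearD _ _ _.
rewrite tlD trD -!comm_tensl -!comm_tensr.
by apply: (PD); apply: (PD); apply: Pcomm.
Qed.

Lemma comm_alt_nucleus (m m' : CC C) :
  alt_nucleus m -> alt_nucleus m' -> comm_mul m m' \in skewv C.
Proof.
move=> /alt_nucleusP[x [y ->]] /alt_nucleusP[z [w ->]].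
rewrite linearDl !linearDr /= comm_tensl comm_tensr comm_tenslr comm_tensrl.
rewrite addr0 add0r; apply/skewvP; exists (comm_mul x z), (comm_mul y w).
by split=> //; apply: polar_comm_one.
Qed.

Lemma skewv_hom (f : 'Hom(CC C, CC C)) :
  bijective f -> (forall x y, f (x ** y) = f x ** f y) ->
  forall t, t \in skewv C -> f t \in skewv C.
Proof.
move=> bf fM; apply: skewv_comm_ind => [s t fs ft|m m' Nm Nm'].
  by rewrite linearD memvD.
rewrite linearB /= !fM.
by apply: comm_alt_nucleus; apply: alt_nucleus_hom.
Qed.

Section Grading.
Variables (G : zmodType) (Gam : G -> {vspace CC C}) (grG : is_grading Gam).
Variables (s : seq G) (pi : G -> 'End(CC C)) (prj : projections Gam s pi).

Lemma skewv_proj g t : t \in skewv C -> pi g t \in skewv C.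
Proof.
move: t; apply: skewv_comm_ind => [x y xS yS|m m' Nm Nm'].
  by rewrite linearD memvD.
rewrite [m'](proj_sum prj) linear_sumr linear_sum memv_suml // => h _.
(* Splitting m' alone is enough: the component of degree g of [m, pi h m'] is
   [pi (g - h) m, pi h m']. *)
have := proj_mulr (comm_grading grG) prj (g - h) m (proj_mem prj h m').
rewrite subrK => /= ->.
by apply: comm_alt_nucleus; apply: alt_nucleus_proj grG prj _ _ _.
Qed.

Lemma induced_is_grading : is_grading (induced_grading Gam).
Proof. exact: (sub_grading (comm_grading grG) prj _ skewv_proj). Qed.

End Grading.

(** Besides S, what is to be reached is x (x) y = (x (x) 1)(1 (x) y) and 1 (x) 1, a multiple of the
    square of a (x) 1 for a skew anisotropic a. *)
Lemma CC_skewv_ind (P : CC C -> Prop) : subspace_pred P ->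
  (forall t, t \in skewv C -> P t) ->
  (forall s t, s \in skewv C -> t \in skewv C -> P (s ** t)) -> forall t, P t.
Proof.
move=> subP PS PSS; have PD := subspace_predD subP; have PZ := subspace_predZ subP.
have Sl x : pol x one = 0 -> tensl x \in skewv C.
  by move=> Sx; apply/skewvP; exists x, 0; rewrite linear0 addr0 linear0l.
have Sr x : pol x one = 0 -> tensr x \in skewv C.
  by move=> Sx; apply/skewvP; exists 0, x; rewrite linear0 add0r linear0l.
have P1 : P (tens one one).
  have [a Sa na] := exists_skew_aniso two_neq0 (cayley_dim_gt (isT : (1 < 8)%N)).
  have -> : tens one one = - (comp_norm a)^-1 *: (tensl a ** tensl a : CC C).
    rewrite tens_mulE comp_mul1l skew_sqr // linearZl_LR scalerA /= mulrNN mulVf //.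
    by rewrite scale1r.
  by apply/PZ/PSS; apply: Sl.
have dec w : exists a x, pol x one = 0 /\ w = a *: one + x.
  by exists (2%:R^-1 * pol w one), (pr w); split; [apply: pr_skew | apply: prE].
apply: tens_ind => // u v; have [a [x [Sx ->]]] := dec u; have [b [y [Sy ->]]] := dec v.
rewrite linearDl !linearDr !linearZl_LR !linearZr_LR /=.
apply: (PD); apply: (PD); first by apply: (PZ); apply: (PZ).
- by apply: PZ; apply: PS; apply: Sr.
- by apply: PZ; apply: PS; apply: Sl.
have -> : tens x y = (tensl x ** tensr y : CC C).
  by rewrite tens_mulE comp_mul1l comp_mulr1.
by apply: PSS; [apply: Sl | apply: Sr].
Qed.

End CayleySquare.

(** * Automorphisms and ideals of S *)

Section SkewAlgebra.
Variables (F : fieldType) (C : cayleyAlgebra F).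
Hypothesis two_neq0 : 2%:R != 0 :> F.
Local Notation one := (comp_one C).
Local Notation pol := (@comp_polar F C).
Local Notation K := (subA (@skew_comm_closed F C)).

Lemma skewA_polar (x : K) : pol (vsval x) one = 0.
Proof. exact/memv_skewP/subvsP. Qed.

Lemma skew_algebra_simple : simple_nalg K.
Proof.
have dim2 : (2 < \dim {:C})%N by apply: cayley_dim_gt.
split.
  have [a Sa na] := exists_skew_aniso two_neq0 (ltnW dim2).
  have norm0 : comp_norm (0 : C) = 0.
    by rewrite -(scale0r (0 : C)) comp_normZ expr0n mul0r.
  have a0 : a != 0 by apply: contraNneq na => ->; rewrite norm0.
  have [b Sb nb] := exists_comm_aniso two_neq0 dim2 Sa a0.
  move/memv_skewP: Sa => Sa; move/memv_skewP: Sb => Sb.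
  exists (Subvs Sa), (Subvs Sb); apply: contraNneq nb => /(congr1 vsval) /= ->.
  by rewrite norm0.
move=> P [[P0 Plin] Pid]; apply: NNPP => /not_or_and[nz nall]; apply: nall => y.
apply: NNPP => Py; apply: nz => x Px; apply: NNPP => x0; apply: Py.
(* The ideal P of C_0 is pulled back to C along a linear projection, since [skew_simple] is about
   predicates on C. *)
pose Q (z : C) := P (vsproj (Defs.skew C) z).
have Qy : Q (vsval y); last by move: Qy; rewrite /Q vsvalK.
apply: (skew_simple two_neq0 dim2 (P := Q) _ _ (skewA_polar x) _ _ (skewA_polar y)).
- by move=> c u v Pu Pv; rewrite /Q linearP; apply: Plin.
- move=> u v Su Sv Pu; move/memv_skewP: Su => Su; move/memv_skewP: Sv => Sv.
  have := (Pid (Subvs Sv) _ Pu).2; rewrite /Q; congr P.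
  by apply: subvs_inj; rewrite /= !vsprojK //; apply: skew_comm_closed.
- by rewrite /Q vsvalK.
- by apply/eqP => x0'; apply: x0; apply: subvs_inj.
Qed.

Lemma exists_leftA_iso : exists f : 'Hom(K, leftA C), bijective f /\
  forall x y, f (x ** y) = f x ** f y.
Proof.
have memL (x : K) : tensl (vsval x) \in leftv C.
  by apply/leftvP; exists (vsval x) => //; apply: subvsP.
have [|f fE] := @exists_linfun F K (leftA C) (fun x => Subvs (memL x)).
  by move=> a x y; apply: subvs_inj; rewrite /= linearP.
exists f; split=> [|x y].
  apply: lfun_bij => [x y|t].
    rewrite !fE => /(congr1 vsval) /= E; apply: subvs_inj.
    have E' : tensl (vsval x) + tensr 0 = tensl (vsval y) + tensr 0 by rewrite E.
    by have [] := skew_tens_inj two_neq0 (skewA_polar x) (linear0l _ _)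
      (skewA_polar y) (linear0l _ _) E'.
  have /leftvP[x Sx tE] := subvsP t; exists (Subvs Sx); rewrite fE.
  exact: subvs_inj.
by rewrite !fE; apply: subvs_inj; rewrite /= comm_tensl.
Qed.

Lemma exists_rightA_iso : exists f : 'Hom(K, rightA C), bijective f /\
  forall x y, f (x ** y) = f x ** f y.
Proof.
have memR (x : K) : tensr (vsval x) \in rightv C.
  by apply/rightvP; exists (vsval x) => //; apply: subvsP.
have [|f fE] := @exists_linfun F K (rightA C) (fun x => Subvs (memR x)).
  by move=> a x y; apply: subvs_inj; rewrite /= linearP.
exists f; split=> [|x y].
  apply: lfun_bij => [x y|t].
    rewrite !fE => /(congr1 vsval) /= E; apply: subvs_inj.
    have E' : tensl 0 + tensr (vsval x) = tensl 0 + tensr (vsval y) by rewrite E.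
    by have [] := skew_tens_inj two_neq0 (linear0l _ _) (skewA_polar x)
      (linear0l _ _) (skewA_polar y) E'.
  have /rightvP[x Sx tE] := subvsP t; exists (Subvs Sx); rewrite fE.
  exact: subvs_inj.
by rewrite !fE; apply: subvs_inj; rewrite /= comm_tensr.
Qed.

Lemma leftA_simple : simple_nalg (leftA C).
Proof.
have [f [bf fM]] := exists_leftA_iso.
exact: simple_transport bf fM skew_algebra_simple.
Qed.

Lemma rightA_simple : simple_nalg (rightA C).
Proof.
have [f [bf fM]] := exists_rightA_iso.
exact: simple_transport bf fM skew_algebra_simple.
Qed.

(** Both factors are the same algebra [K], so the two components of an automorphism of S are
    automorphisms of [K] even when the factors are exchanged. *)
Lemma exists_skewA_iso : exists f : 'Hom(prodA K K, skewA C),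
  [/\ bijective f, forall x y, f (x ** y) = f x ** f y
    & forall x, vsval (f x) = tensl (vsval x.1) + tensr (vsval x.2)].
Proof.
have memS (x : prodA K K) : tensl (vsval x.1) + tensr (vsval x.2) \in skewv C.
  by apply/skewvP; exists (vsval x.1), (vsval x.2); split=> //; apply: skewA_polar.
have [|f fE] := @exists_linfun F (prodA K K) (skewA C) (fun x => Subvs (memS x)).
  by move=> a x y; apply: subvs_inj; rewrite /= !linearP /= scalerDr addrACA.
exists f; split=> [|x y|x]; last by rewrite fE.
  apply: lfun_bij => [[a b] [c d]|t].
    rewrite !fE => /(congr1 vsval) /= E.
    have [/subvs_inj -> /subvs_inj ->] := skew_tens_inj two_neq0 (skewA_polar a)
      (skewA_polar b) (skewA_polar c) (skewA_polar d) E.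
    by [].
  have /skewvP[x [y [/memv_skewP Sx /memv_skewP Sy tE]]] := subvsP t.
  by exists (Subvs Sx, Subvs Sy); rewrite fE; apply: subvs_inj.
rewrite !fE; apply: subvs_inj; rewrite /= linearDl !linearDr /=.
by rewrite comm_tensl comm_tensr comm_tenslr comm_tensrl addr0 add0r.
Qed.

Lemma left_right_mul (x y : commA (CC C)) : x \in leftv C -> y \in rightv C ->
  x ** y = 0 /\ y ** x = 0.
Proof.
move=> /leftvP[a _ ->] /rightvP[b _ ->].
by split; [apply: comm_tenslr | apply: comm_tensrl].
Qed.

(** * Extending an automorphism of S to the tensor square *)

Lemma skew_algebra_aut_ext (u : 'Hom(K, K)) :
  bijective u -> (forall x y, u (x ** y) = u x ** u y) ->
  exists alpha : 'End(C), [/\ bijective alpha,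
    forall x y, alpha (x ** y) = alpha x ** alpha y, alpha one = one
    & forall x : K, alpha (vsval x) = vsval (u x)].
Proof.
move=> bu uM; pose phi (x : C) : C := vsval (u (vsproj (Defs.skew C) x)).
have phi_lin : linear phi by move=> a x y; rewrite /phi linearP linearP.
pose phiB := GRing.isLinear.Build F C C *:%R phi phi_lin.
pose phiL : {linear C -> C} := HB.pack_for {linear C -> C} phi phiB.
have dim2 : (2 < \dim {:C})%N by apply: cayley_dim_gt.
have [||x y Sx Sy|alpha alphaE [alpha1 alpha_inj alphaM]] :=
  @skew_automorphism_ext F C two_neq0 dim2 phiL.
- by move=> x Sx; apply: skewA_polar.
- move=> x /memv_skewP Sx phix; rewrite -(vsprojK Sx).
  have : u (vsproj (Defs.skew C) x) = u 0 by rewrite linear0; apply: subvs_inj.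
  by move/(bij_inj bu) ->.
- move/memv_skewP: Sx => Sx; move/memv_skewP: Sy => Sy.
  rewrite /= /phi -[RHS]/(vsval (u _ ** u _)) -uM; congr (vsval (u _)).
  by apply: subvs_inj; rewrite /= !vsprojK //; apply: skew_comm_closed.
have surj : bijective (linfun alpha).
  have ker0 : lker (linfun alpha) == 0%VS.
    by apply/lker0P => x y; rewrite !lfunE; apply: alpha_inj.
  exists (linfun alpha)^-1%VF; first exact: lker0_lfunK.
  exact: lker0_lfunVK.
exists (linfun alpha); split=> // [x y||x]; rewrite !lfunE //.
by rewrite alphaE /= /phi ?vsvalK //; apply: skewA_polar.
Qed.

Lemma surj_lfun_bij (V : vectType F) (h : 'End(V)) :
  (forall t, exists s, h s = t) -> bijective h.
Proof.
move=> surj; have full : limg h = fullv.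
  apply/eqP; rewrite eqEsubv subvf; apply/subvP => t _.
  by have [s <-] := surj t; rewrite memv_img ?memvf.
have ker0 : lker h == 0%VS.
  by rewrite -dimv_eq0 -(eqn_add2r (\dim (limg h))) -{1}[lker h]capfv limg_ker_dim full.
by exists h^-1%VF; [apply: lker0_lfunK | apply: lker0_lfunVK].
Qed.

(** Stated for a bilinear map so as to serve both alpha (x) beta and its composite with the swap;
    surjectivity on pure tensors gives bijectivity by dimension. *)
Lemma exists_tens_aut (b : C -> C -> CC C) :
  bilinear_for *:%R *:%R b ->
  (forall x y z w, b (x ** z) (y ** w) = (b x y : CC C) ** b z w) ->
  (forall x y, exists z w, tens x y = b z w) ->
  exists Phi : 'End(CC C), [/\ bijective Phi,
    forall x y, Phi (x ** y) = Phi x ** Phi y & forall x y, Phi (tens x y) = b x y].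
Proof.
move=> bil_b bM b_surj; have [Phi PhiE] := exists_tens_lift bil_b.
exists (Phi : 'End(CC C)); split=> //.
  apply: (@surj_lfun_bij (CC C)); apply: tens_ind => [|u v].
    split; first by exists 0; rewrite linear0.
    by move=> a x y [s <-] [t <-]; exists (a *: s + t); rewrite linearP.
  by have [z [w ->]] := b_surj u v; exists (tens z w).
move=> s t; move: s; apply: tens_ind => [|x y].
  split; first by rewrite linear0l linear0 linear0l.
  by move=> a s s' E E'; rewrite linearPl linearP /= E E' linearP linearPl.
move: t; apply: tens_ind => [|z w].
  split; first by rewrite linear0r linear0 linear0r.
  by move=> a t t' E E'; rewrite linearPr linearP /= E E' linearP linearPr.
by rewrite tens_mulE !PhiE bM.
Qed.

Lemma skewA_aut_ext (psi : 'Hom(skewA C, skewA C)) :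
  bijective psi -> (forall x y, psi (x ** y) = psi x ** psi y) ->
  exists Phi : 'End(CC C), [/\ bijective Phi,
    forall x y, Phi (x ** y) = Phi x ** Phi y
    & forall s : skewA C, Phi (vsval s) = vsval (psi s)].
Proof.
move=> bpsi psiM; have [J [bJ JM JE]] := exists_skewA_iso.
have [JK JVK] := bijective_lfunVK bJ.
pose f := (J^-1 \o psi \o J)%VF.
have fE x : f x = (J^-1)%VF (psi (J x)) by rewrite !comp_lfunE.
have Jf x : J (f x) = psi (J x) by rewrite fE JVK.
have bf : bijective f.
  have bJV : bijective J^-1%VF by exists J.
  by apply: (eq_bij (bij_comp bJV (bij_comp bpsi bJ))) => x; rewrite fE.
have fM x y : f (x ** y) = f x ** f y.
  by apply: (bij_inj bJ); rewrite JM !Jf JM psiM.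
have sK := skew_algebra_simple.
have one_one : (one ** one : C) = one by rewrite comp_mul1l.
case: (simple_prod_iso sK sK sK sK bf fM) => -[u [v [bu uM bv vM uvE]]];
  have [alpha [balpha alphaM alpha1 alphaE]] := skew_algebra_aut_ext bu uM;
  have [beta [bbeta betaM beta1 betaE]] := skew_algebra_aut_ext bv vM;
  have [alphaK alphaVK] := bijective_lfunVK balpha;
  have [betaK betaVK] := bijective_lfunVK bbeta.
- have [|||Phi [bPhi PhiM PhiE]] := @exists_tens_aut (fun x y => tens (alpha x) (beta y)).
  + split=> [y|x] a z w /=; first by rewrite linearP linearPl.
    by rewrite linearP linearPr.
  + by move=> x y z w; rewrite tens_mulE alphaM betaM.
  + by move=> x y; exists (alpha^-1%VF x), (beta^-1%VF y); rewrite alphaVK betaVK.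
  exists Phi; split=> // s; rewrite -[s]JVK -Jf; case: (J^-1%VF s) => x y.
  rewrite uvE !JE linearD /= !PhiE alpha1 beta1 alphaE betaE.
  by [].
(* Here x (x) 1 + 1 (x) y goes to v y (x) 1 + 1 (x) u x, which dictates the exchange of the
   factors. *)
- have [|||Phi [bPhi PhiM PhiE]] := @exists_tens_aut (fun x y => tens (beta y) (alpha x)).
  + split=> [y|x] a z w /=; first by rewrite linearP linearPr.
    by rewrite linearP linearPl.
  + by move=> x y z w; rewrite tens_mulE alphaM betaM.
  + by move=> x y; exists (alpha^-1%VF y), (beta^-1%VF x); rewrite alphaVK betaVK.
  exists Phi; split=> // s; rewrite -[s]JVK -Jf; case: (J^-1%VF s) => x y.
  rewrite uvE !JE linearD /= !PhiE alpha1 beta1 alphaE betaE.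
  exact: addrC.
Qed.

(** * Isomorphism of gradings and of the induced gradings *)

Section TwoGradings.
Variables (G : zmodType) (Gam Gam' : G -> {vspace CC C}).
Hypotheses (grG : is_grading Gam) (grG' : is_grading Gam').

Lemma graded_iso_induced :
  graded_iso Gam Gam' -> graded_iso (induced_grading Gam) (induced_grading Gam').
Proof.
move=> /graded_iso_mem[f [bf fM fG]]; have [fK fVK] := bijective_lfunVK bf.
have fS := skewv_hom two_neq0 bf fM.
have fVS t : t \in skewv C -> f^-1%VF t \in skewv C.
  apply: skewv_hom => //; first by exists f.
  by move=> x y; apply: (bij_inj bf); rewrite fM !fVK.
have [|h hE] := @exists_linfun F (skewA C) (skewA C) (fun s => Subvs (fS _ (subvsP s))).
  by move=> a x y; apply: subvs_inj; rewrite /= linearP.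
apply/graded_iso_mem; exists h; split=> [|x y|g x].
- apply: lfun_bij => [x y|y].
    by rewrite !hE => /(congr1 vsval) /= /(bij_inj bf) /subvs_inj.
  exists (Subvs (fVS _ (subvsP y))); rewrite hE; apply: subvs_inj.
  by rewrite /= fVK.
- by rewrite !hE; apply: subvs_inj; rewrite /= /comm_mul linearB /= !fM.
- by rewrite !memv_restrv hE /= fG.
Qed.

(* C (x) C is spanned by S and S S, so a grading is determined by its
   restriction to S. *)
Lemma graded_iso_of_induced :
  graded_iso (induced_grading Gam) (induced_grading Gam') -> graded_iso Gam Gam'.
Proof.
move=> /graded_iso_mem[psi [bpsi psiM psiG]].
have [Phi [bPhi PhiM PhiE]] := skewA_aut_ext bpsi psiM.
apply: (graded_iso_of_sub grG grG' bPhi PhiM).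
have [s [pi pr]] := grading_projections grG.
have [s' [pi' pr']] := grading_projections grG'.
(* Commuting with the projections is a linear condition on t, so it can be checked on homogeneous
   elements of S and on their products. *)
pose Q (t : CC C) := forall g, Phi (pi g t) = pi' g (Phi t).
have Qlin : subspace_pred Q.
  split=> [g|a x y Qx Qy g]; first by rewrite !linear0.
  by rewrite !linearP /= Qx Qy.
have Q0 := Qlin.1; have QD := subspace_predD Qlin.
have Qhom h x : x \in Gam h -> Phi x \in Gam' h -> Q x.
  move=> xh Phixh g; have [<-|gh] := eqVneq h g.
    by rewrite (proj_id pr) // (proj_id pr').
  by rewrite (proj_off pr xh) 1?eq_sym // (proj_off pr' Phixh) 1?eq_sym // linear0.
have PhiS h x : x \in skewv C -> Phi (pi h x) \in Gam' h.
  move=> xS; have yS := skewv_proj two_neq0 grG pr h xS.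
  rewrite -[pi h x]/(vsval (Subvs yS)) PhiE.
  have := psiG h (Subvs yS); rewrite !memv_restrv => ->.
  exact: proj_mem pr _ _.
have Qall : forall t, Q t.
  apply: (CC_skewv_ind two_neq0 Qlin) => [t tS|x y xS yS].
    rewrite [t](proj_sum pr); apply: big_ind => // h _.
    by apply: (Qhom h); [apply: proj_mem pr _ _ | apply: PhiS].
  rewrite [x](proj_sum pr) linear_sumlz; apply: big_ind => // h _.
  rewrite [y](proj_sum pr) linear_sumr; apply: big_ind => // k _.
  apply: (Qhom (h + k)); first by apply: (grading_mul grG); apply: (proj_mem pr).
  by rewrite PhiM; apply: (grading_mul grG'); apply: PhiS.
move=> g x xg; apply/(memv_proj_id pr').
by rewrite -Qall (proj_id pr).
Qed.

End TwoGradings.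

(** * The ideals of S *)

Section SkewIdeals.
Local Notation LR := (prodA (leftA C) (rightA C)).

Lemma exists_internal_iso : exists f : 'Hom(LR, skewA C),
  [/\ bijective f, forall x y, f (x ** y) = f x ** f y,
    forall x, (f x \in left_ideal C) = (x.2 == 0)
    & forall x, (f x \in right_ideal C) = (x.1 == 0)].
Proof.
have [f [bf fM fE]] := @internal_prod F (commA (CC C)) (leftv C) (rightv C)
  (@leftv_closed F C) (@rightv_closed F C) (@skewv_closed F C) left_right_mul
  (cap_leftv_rightv C two_neq0).
have cap0 (t : CC C) : t \in leftv C -> t \in rightv C -> t = 0.
  by move=> tl tr; apply/eqP; rewrite -memv0 -(cap_leftv_rightv C two_neq0) memv_cap tl.
exists f; split=> // x; rewrite memv_restrv fE.
  rewrite rpredDl ?subvsP //; apply/idP/eqP => [xl|->]; last by rewrite linear0 mem0v.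
  by apply: subvs_inj; apply: cap0 xl (subvsP _).
rewrite rpredDr ?subvsP //; apply/idP/eqP => [xr|->]; last by rewrite linear0 mem0v.
by apply: subvs_inj; apply: cap0 (subvsP _) xr.
Qed.

(** An element (a, b) annihilating all (0, d) has b = 0 because [rightA] is simple. Through
    [annihilator_graded], this makes the left ideal graded as soon as the right one is. *)
Lemma left_ideal_annihilator (s : skewA C) : s \in left_ideal C <->
  forall t, t \in right_ideal C -> s ** t = 0 /\ t ** s = 0.
Proof.
have [f [bf fM fl fr]] := exists_internal_iso; have [_ fVK] := bijective_lfunVK bf.
rewrite -[s]fVK fl; case: (f^-1%VF s) => a b /=; split=> [/eqP -> t|H].
  rewrite -[t]fVK fr -!fM; case: (f^-1%VF t) => c d /= /eqP ->.
  by rewrite /= /prod_mul /= !(linear0l, linear0r) linear0.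
apply/eqP/(simple_center rightA_simple) => d.
have [] := H (f (0, d)); first by rewrite fr.
rewrite -!fM -(linear0 f) => /(bij_inj bf)/(congr1 snd) E /(bij_inj bf)/(congr1 snd) E'.
exact: (conj E E').
Qed.

Lemma right_ideal_annihilator (s : skewA C) : s \in right_ideal C <->
  forall t, t \in left_ideal C -> s ** t = 0 /\ t ** s = 0.
Proof.
have [f [bf fM fl fr]] := exists_internal_iso; have [_ fVK] := bijective_lfunVK bf.
rewrite -[s]fVK fr; case: (f^-1%VF s) => a b /=; split=> [/eqP -> t|H].
  rewrite -[t]fVK fl -!fM; case: (f^-1%VF t) => c d /= /eqP ->.
  by rewrite /= /prod_mul /= !(linear0l, linear0r) linear0.
apply/eqP/(simple_center leftA_simple) => c.
have [] := H (f (c, 0)); first by rewrite fl.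
rewrite -!fM -(linear0 f) => /(bij_inj bf)/(congr1 fst) E /(bij_inj bf)/(congr1 fst) E'.
exact: (conj E E').
Qed.

Lemma left_ideal_closed (s t : skewA C) :
  t \in left_ideal C -> s ** t \in left_ideal C /\ t ** s \in left_ideal C.
Proof.
have [f [bf fM fl fr]] := exists_internal_iso; have [_ fVK] := bijective_lfunVK bf.
rewrite -[s]fVK -[t]fVK -!fM !fl => /eqP; rewrite /= => ->.
by rewrite linear0l linear0r.
Qed.

Lemma right_ideal_closed (s t : skewA C) :
  t \in right_ideal C -> s ** t \in right_ideal C /\ t ** s \in right_ideal C.
Proof.
have [f [bf fM fl fr]] := exists_internal_iso; have [_ fVK] := bijective_lfunVK bf.
rewrite -[s]fVK -[t]fVK -!fM !fr => /eqP; rewrite /= => ->.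
by rewrite linear0l linear0r.
Qed.

Lemma skewA_mul_neq0 : exists x y : skewA C, x ** y != 0.
Proof.
have [f [bf fM fl fr]] := exists_internal_iso.
have [[x [y xy]] _] := leftA_simple; exists (f (x, 0)), (f (y, 0)).
apply: contraNneq xy; rewrite -fM -(linear0 f).
by move=> /(bij_inj bf)/(congr1 fst) E; apply/eqP.
Qed.

Lemma left_ideal_proper : left_ideal C <> 0%VS /\ left_ideal C <> fullv.
Proof.
have [f [bf fM fl fr]] := exists_internal_iso.
have [x x0] := simple_neq0 leftA_simple; have [y y0] := simple_neq0 rightA_simple.
split=> E.
  have : f (x, 0) \in left_ideal C by rewrite fl.
  by rewrite E memv0 -(linear0 f) => /eqP/(bij_inj bf)[] /eqP; rewrite (negPf x0).
have : f (0, y) \in left_ideal C by rewrite E memvf.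
by rewrite fl /= (negPf y0).
Qed.

Lemma skewA_ideals (I : {vspace skewA C}) :
  (forall x y, y \in I -> x ** y \in I /\ y ** x \in I) ->
  [\/ I = 0%VS, I = left_ideal C, I = right_ideal C | I = fullv].
Proof.
move=> idI; have [f [bf fM fl fr]] := exists_internal_iso.
have [_ fVK] := bijective_lfunVK bf.
have idealI : ideal_pred (fun x : LR => f x \in I).
  split; first split; first by rewrite linear0 mem0v.
    by move=> a x y xI yI; rewrite linearP memvD ?memvZ.
  by move=> x y yI; rewrite !fM; apply: idI.
case: (simple_prod_ideal leftA_simple rightA_simple idealI) => H.
- constructor 1; apply/eqP; rewrite -subv0; apply/subvP => x.
  by rewrite -[x]fVK => /H ->; rewrite linear0 mem0v.
- constructor 2; apply/vspaceP => x; rewrite -[x]fVK fl.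
  by apply/idP/eqP => /H.
- constructor 3; apply/vspaceP => x; rewrite -[x]fVK fr.
  by apply/idP/eqP => /H.
- by constructor 4; apply/vspaceP => x; rewrite -[x]fVK H memvf.
Qed.

End SkewIdeals.

(** * Graded ideals of S and the product decomposition *)

Section GradedSimple.
Variables (G : zmodType) (Gam : G -> {vspace CC C}).
Hypothesis grG : is_grading Gam.
Local Notation Gam0 := (induced_grading Gam).

Lemma induced_grading_is_grading : is_grading Gam0.
Proof.
have [s [pi pr]] := grading_projections grG.
exact: (induced_is_grading two_neq0 grG pr).
Qed.

(** The product of S is nonzero, so some proper nonzero ideal is graded; it is one of the two
    summands, and the other is its annihilator. *)
Lemma graded_ideals_of_not_simple : ~ graded_simple Gam0 ->
  is_graded_ideal Gam0 (left_ideal C) /\ is_graded_ideal Gam0 (right_ideal C).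
Proof.
move=> /not_and_or[/(_ skewA_mul_neq0) //|] /not_all_ex_not[I].
move=> HI; have [[idI grI] /not_or_and[I0 If]] := imply_to_and _ _ HI.
have gr0 := induced_grading_is_grading.
have [s [pi pr]] := grading_projections gr0.
move/(graded_subspaceP pr): grI => grI.
case: (skewA_ideals idI) => [/I0|IE|IE|/If] //; rewrite {}IE in grI.
- have grL := grI; have grR := annihilator_graded gr0 pr right_ideal_annihilator grI.
  split; split; [exact: left_ideal_closed | exact/(graded_subspaceP pr)
    | exact: right_ideal_closed | exact/(graded_subspaceP pr)].
- have grR := grI; have grL := annihilator_graded gr0 pr left_ideal_annihilator grI.
  split; split; [exact: left_ideal_closed | exact/(graded_subspaceP pr)
    | exact: right_ideal_closed | exact/(graded_subspaceP pr)].
Qed.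

Lemma not_simple_of_graded_ideal :
  is_graded_ideal Gam0 (left_ideal C) -> ~ graded_simple Gam0.
Proof.
by move=> grL [_ /(_ _ grL)]; have [l0 lf] := left_ideal_proper; case.
Qed.

Lemma induced_prod_grading :
  is_graded_ideal Gam0 (left_ideal C) -> is_graded_ideal Gam0 (right_ideal C) ->
  exists (Gam1 : G -> {vspace leftA C}) (Gam2 : G -> {vspace rightA C}),
    [/\ is_grading Gam1, is_grading Gam2 & graded_iso Gam0 (prod_grading Gam1 Gam2)].
Proof.
have [s [pi pr]] := grading_projections grG.
have [s0 [pi0 pr0]] := grading_projections induced_grading_is_grading.
(* The projections of the induced grading restrict those of [Gam], so stability inside S becomes
   stability inside C (x) C. *)
have vsval_proj g x : vsval (pi0 g x) = pi g (vsval x).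
  apply: (proj_comm (f := vsval : {linear skewA C -> CC C}) pr0 pr) => h y.
  by rewrite memv_restrv.
have stab (U : {vspace CC C}) : (U <= skewv C)%VS ->
    (forall g x, x \in restrv (@skewv_closed F C) U ->
      pi0 g x \in restrv (@skewv_closed F C) U) ->
    forall g t, t \in U -> pi g t \in U.
  move=> /subvP US stU g t tU; have := stU g (Subvs (US _ tU)).
  by rewrite !memv_restrv vsval_proj; apply.
move=> [_ /(graded_subspaceP pr0) grL] [_ /(graded_subspaceP pr0) grR].
have stL := stab _ (addvSl _ _) grL; have stR := stab _ (addvSr _ _) grR.
exists (fun g => restrv (@leftv_closed F C) (Gam g)).
exists (fun g => restrv (@rightv_closed F C) (Gam g)).
have grC := comm_grading grG; split.
- exact: (sub_grading grC pr _ stL).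
- exact: (sub_grading grC pr _ stR).
- exact: (@internal_prod_graded_iso F (commA (CC C)) (leftv C) (rightv C)
    (@leftv_closed F C) (@rightv_closed F C) (@skewv_closed F C) left_right_mul
    (cap_leftv_rightv C two_neq0) G Gam s pi pr stL stR).
Qed.

End GradedSimple.
End SkewAlgebra.

Theorem proposition3p18 (F : closedFieldType) (char_neq2 : 2%N \notin [pchar F])
    (C : cayleyAlgebra F) (G : zmodType) :
  (forall Gam : G -> {vspace CC C}, is_grading Gam ->
     (~ graded_simple (induced_grading Gam) <->
        is_graded_ideal (induced_grading Gam) (left_ideal C) /\
        is_graded_ideal (induced_grading Gam) (right_ideal C)) /\
     (~ graded_simple (induced_grading Gam) ->
        exists (Gam1 : G -> {vspace leftA C}) (Gam2 : G -> {vspace rightA C}),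
          [/\ is_grading Gam1, is_grading Gam2
            & graded_iso (induced_grading Gam) (prod_grading Gam1 Gam2)])) /\
  (forall (Gam Gam' : G -> {vspace CC C})
     (Gam1 Gam1' : G -> {vspace leftA C}) (Gam2 Gam2' : G -> {vspace rightA C}),
     is_grading Gam -> is_grading Gam' ->
     is_grading Gam1 -> is_grading Gam1' ->
     is_grading Gam2 -> is_grading Gam2' ->
     graded_iso (induced_grading Gam) (prod_grading Gam1 Gam2) ->
     graded_iso (induced_grading Gam') (prod_grading Gam1' Gam2') ->
     (graded_iso Gam Gam' <->
        (graded_iso Gam1 Gam1' /\ graded_iso Gam2 Gam2') \/
        (graded_iso Gam1 Gam2' /\ graded_iso Gam2 Gam1'))).
Proof.
have two_neq0 : 2%:R != 0 :> F by move: char_neq2; rewrite inE.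
split=> [Gam grG|Gam Gam' Gam1 Gam1' Gam2 Gam2' grG grG' _ _ _ _ iso iso'].
  split=> [|nsimple].
    split; first exact: graded_ideals_of_not_simple.
    by move=> [grL _]; apply: not_simple_of_graded_ideal.
  have [grL grR] := graded_ideals_of_not_simple two_neq0 grG nsimple.
  exact: induced_prod_grading.
have sL := leftA_simple C two_neq0; have sR := rightA_simple C two_neq0.
(* The alternative on the factors becomes an isomorphism of the product gradings, that is, of the
   induced gradings on S. *)
rewrite -(simple_prod_graded_iso Gam1 Gam2 Gam1' Gam2' sL sR sL sR); split=> [isoG|isoP].
  apply: graded_iso_trans (graded_iso_sym iso) (graded_iso_trans _ iso').
  exact: graded_iso_induced.
apply: graded_iso_of_induced => //.
exact: graded_iso_trans iso (graded_iso_trans isoP (graded_iso_sym iso')).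
Qed.
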